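(* Let $\mathsf R$ be an ordered ring, $\mathsf C=\mathsf R(i)$ with $i^2=-1$. Let $\mathcal A_{\mathrm{red}}$ and $\mathcal B$ be unital $^*$-algebras over $\mathsf C$, $\mathcal A=\mathcal B\otimes_{\mathsf C}\mathcal A_{\mathrm{red}}$, $\mathcal B_0\subseteq\mathcal B$ a $^*$-ideal, $\omega:\mathcal B_0\to\mathsf C$ a positive linear functional with Gel'fand ideal $\mathcal J_\omega$, and $\mathcal E=(\mathcal B_0/\mathcal J_\omega)\otimes_{\mathsf{ext}}\mathcal A_{\mathrm{red}}$, a pre Hilbert right $\mathcal A_{\mathrm{red}}$-module with its canonical $^*$-representation of $\mathcal A$. Let $\mathcal D$ be an auxiliary $^*$-algebra over $\mathsf C$, and let $\mathsf R_{\mathcal E}(\cdot)=\mathcal E\,\widehat\otimes_{\mathcal A_{\mathrm{red}}}\cdot$ be the Rieffel induction functor. Then there is a natural equivalence of functors $$\mathsf R_{\mathcal E}(\cdot)\cong(\mathcal B_0/\mathcal J_\omega)\otimes_{\mathsf{ext}}\cdot\;:\;{}^*\text{-}\mathsf{Rep}_{\mathcal D}(\mathcal A_{\mathrm{red}})\longrightarrow{}^*\text{-}\mathsf{Rep}_{\mathcal D}(\mathcal A).$$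
   Context: A $^*$-algebra over $\mathsf C$ is an associative algebra with a $\mathsf C$-antilinear involutive anti-automorphism $^*$. A linear functional $\omega$ is positive if $\omega(b^*b)\ge0$ for all $b$; its Gel'fand ideal is $\mathcal J_\omega=\{b\in\mathcal B_0:\omega(b^*b)=0\}$, and $\mathcal B_0/\mathcal J_\omega$ is a pre Hilbert space over $\mathsf C$ with $\langle[b],[b']\rangle=\omega(b^*b')$, on which $\mathcal B$ acts by the (extended) GNS representation $b\cdot[b']=[bb']$. A pre Hilbert right $\mathcal D$-module is a right $\mathcal D$-module (with compatible $\mathsf C$-module structure) and a non-degenerate $\mathcal D$-valued inner product, $\mathsf C$-linear and right $\mathcal D$-linear in the second argument, $\langle x,y\rangle=\langle y,x\rangle^*$, completely positive: every matrix $(\langle x_i,x_j\rangle)\in M_n(\mathcal D)$ has non-negative value under all positive linear functionals of $M_n(\mathcal D)$. ${}^*\text{-}\mathsf{Rep}_{\mathcal D}(\mathcal A)$ is the category of strongly non-degenerate $^*$-representations of $\mathcal A$ on pre Hilbert right $\mathcal D$-modules: $^*$-homomorphisms of $\mathcal A$ into the adjointable operators, with $\mathcal A\cdot\mathcal H=\mathcal H$ (for unital $\mathcal A$: $\mathbb 1\cdot x=x$); morphisms are adjointable left $\mathcal A$-linear maps. External tensor product: for pre Hilbert right $\mathcal A_i$-modules $\mathcal E_i$ ($i=1,2$), $\mathcal E_1\otimes_{\mathsf{ext}}\mathcal E_2$ is the quotient of $\mathcal E_1\otimes_{\mathsf C}\mathcal E_2$ by the degeneracy space of the $\mathcal A_1\otimes\mathcal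 A_2$-valued inner product $\langle x\otimes x',y\otimes y'\rangle=\langle x,y\rangle\otimes\langle x',y'\rangle$. For $\mathcal E_1=\mathcal B_0/\mathcal J_\omega$ (with $\mathcal A_1=\mathsf C$) and $\mathcal E_2=\mathcal H$ a $^*$-representation of $\mathcal A_{\mathrm{red}}$ on a pre Hilbert right $\mathcal D$-module, the result is a pre Hilbert right $\mathcal D$-module with $^*$-representation of $\mathcal A$ given by $(b\otimes a)\cdot([b']\otimes\phi)=[bb']\otimes(a\cdot\phi)$. In $\mathcal E$, $\mathcal A_{\mathrm{red}}$ is a right module over itself with $\langle a,a'\rangle=a^*a'$, so that $\langle[b]\otimes a,[b']\otimes a'\rangle=\omega(b^*b')a^*a'$. Internal tensor product: for $\mathcal E$ a $^*$-representation of $\mathcal A$ on a pre Hilbert right $\mathcal A_{\mathrm{red}}$-module and $\mathcal H\in{}^*\text{-}\mathsf{Rep}_{\mathcal D}(\mathcal A_{\mathrm{red}})$, $\mathcal E\,\widehat\otimes_{\mathcal A_{\mathrm{red}}}\mathcal H$ is the quotient of $\mathcal E\otimes_{\mathcal A_{\mathrm{red}}}\mathcal H$ by the degeneracy space of the $\mathcal D$-valued inner product $\langle x\otimes\phi,y\otimes\psi\rangle=\langle\phi,\langle x,y\rangle_{\mathcal A_{\mathrm{red}}}\cdot\psi\rangle$, with $\mathcal A$ acting on the first factor. *)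

(* Defs.v *)
From HB Require Import structures.
From mathcomp Require Import all_boot all_order all_algebra.
From mathcomp Require Import generic_quotient boolp.
From mathcomp.algebra_tactics Require Import ring lra.
From mathcomp.real_closed Require Import complex.
From mathcomp.multinomials Require Import freeg.

Set Implicit Arguments.
Unset Strict Implicit.
Unset Printing Implicit Defensive.

Import Order.TTheory GRing.Theory Num.Theory.
Local Open Scope ring_scope.
Local Open Scope quotient_scope.

Local Obligation Tactic := idtac.

(* The library equips [R[i]] with a ring structure only when [R] is a field;
   [Ci R] is the same type, with the same operations, over an ordered ring. *)
Definition Ci (R : realDomainType) : Type := R[i].

Section Scalars.
Variable R : realDomainType.
Local Notation C := (Ci R).

HB.instance Definition _ := GRing.Zmodule.copy C R[i].

Let c1 : C := Complex 1 0.

Lemma Ci_mul1 : left_id c1 (@ComplexField.mulc R : C -> C -> C).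
Proof. by case=> a b /=; rewrite !mul1r !mul0r subr0 addr0. Qed.

Lemma Ci_mulDl : left_distributive (@ComplexField.mulc R : C -> C -> C) +%R.
Proof.
case=> [a b] [c d] [e f].
by rewrite /GRing.add /=; congr Complex; rewrite ?mulrDl; ring.
Qed.

Lemma Ci_1neq0 : c1 != 0.
Proof. by rewrite eq_complex /= oner_eq0. Qed.

HB.instance Definition _ := GRing.Zmodule_isComNzRing.Build C
  (@ComplexField.mulcA R) (@ComplexField.mulcC R) Ci_mul1 Ci_mulDl Ci_1neq0.

Definition Ci_conj (z : C) : C := conjc z.

Definition Ci_ge0 (z : C) : bool := (complex.Im z == 0) && (0 <= complex.Re z).

Lemma Ci_conjD : {morph Ci_conj : z w / z + w}.
Proof. by case=> a b [c d]; rewrite /GRing.add /= opprD. Qed.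

Lemma Ci_conjM : {morph Ci_conj : z w / z * w}.
Proof.
by case=> a b [c d]; rewrite /GRing.mul /=; congr Complex; ring.
Qed.

Lemma Ci_conjK : involutive Ci_conj.
Proof. by case=> a b /=; rewrite opprK. Qed.

Lemma Ci_conj0 : Ci_conj 0 = 0.
Proof. by apply/eqP; rewrite eq_complex /= oppr0 !eqxx. Qed.

Lemma Ci_conj1 : Ci_conj 1 = 1.
Proof. by apply/eqP; rewrite eq_complex /= oppr0 !eqxx. Qed.

Lemma Ci_ge00 : Ci_ge0 0.
Proof. by rewrite /Ci_ge0 /= eqxx lexx. Qed.

Lemma Ci_ge0D z w : Ci_ge0 z -> Ci_ge0 w -> Ci_ge0 (z + w).
Proof.
case: z w => [a b] [c d] /andP[/= /eqP-> ha] /andP[/= /eqP-> hc].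
by rewrite /Ci_ge0 /= addr0 eqxx addr_ge0.
Qed.

Lemma Ci_ge0M z w : Ci_ge0 z -> Ci_ge0 w -> Ci_ge0 (z * w).
Proof.
case: z w => [a b] [c d] /andP[/= /eqP-> ha] /andP[/= /eqP-> hc].
by rewrite /Ci_ge0 /= !mulr0 !mul0r addr0 subr0 eqxx mulr_ge0.
Qed.

Lemma Ci_ge0_conj z : Ci_ge0 z -> Ci_conj z = z.
Proof. by case: z => a b /andP[/= /eqP-> _]; rewrite /Ci_conj /= oppr0. Qed.

Lemma Ci_ge0_sum (I : Type) (s : seq I) (P : pred I) (F : I -> C) :
  (forall i, P i -> Ci_ge0 (F i)) -> Ci_ge0 (\sum_(i <- s | P i) F i).
Proof. by move=> h; elim/big_ind: _ => //; [exact: Ci_ge00|exact: Ci_ge0D]. Qed.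

Lemma Ci_ge0_normsq z : Ci_ge0 (Ci_conj z * z).
Proof.
case: z => a b; rewrite /Ci_ge0 /Ci_conj /=; apply/andP; split.
  by apply/eqP; ring.
by rewrite mulNr opprK addr_ge0 // -expr2 sqr_ge0.
Qed.

Lemma Ci_ge0_cancel g z : Ci_ge0 g -> g != 0 -> Ci_ge0 (g * z) -> Ci_ge0 z.
Proof.
case: g z => [a b] [c d] /andP[/= /eqP-> ha] hn.
have a0 : 0 < a.
  by rewrite lt_def ha andbT; move: hn; rewrite eq_complex /= eqxx andbT.
rewrite /Ci_ge0 /= !mul0r addr0 subr0 => /andP[].
by rewrite mulf_eq0 gt_eqF //= => -> /=; rewrite pmulr_rge0.
Qed.

Lemma Ci_normsq_cube_le0 (d c : C) : Ci_ge0 d ->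
  let N := Ci_conj c * c in
  Ci_ge0 (N * N * d - (N * N * (d + N) + N * N * (d + N))) -> c = 0.
Proof.
move=> hd N; have hN : Ci_ge0 N by exact: Ci_ge0_normsq.
suff NE : complex.Re N = 0 -> c = 0.
  case: d hd N hN NE => [d0 d1] /andP[/= /eqP -> hd0].
  move=> N; move: N => [n m] /andP[/= /eqP -> hn] NE h; apply: NE.
  have {h} : 0 <= n * n * d0 - (n * n * (d0 + n) + n * n * (d0 + n)).
    move: h; rewrite /Ci_ge0 => /andP[_].
    rewrite [X in 0 <= X](_ : _ =
       n * n * d0 - (n * n * (d0 + n) + n * n * (d0 + n))) //=.
    by rewrite /=; ring.
  move=> h; apply/eqP; rewrite eq_le hn andbT leNgt; apply/negP => n0.
  have h1 : 0 < n * n * n by rewrite !mulr_gt0.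
  have h2 : 0 <= n * n * d0 by rewrite !mulr_ge0.
  lra.
rewrite /N; case: c {N hN} => a b /=; rewrite mulNr opprK -!expr2 => /eqP.
rewrite paddr_eq0 ?sqr_ge0 // !sqrf_eq0 => /andP[/eqP-> /eqP->].
by apply/eqP; rewrite eq_complex /= !eqxx.
Qed.

End Scalars.

Section Psd.
Variables (R : realDomainType).
Local Notation C := (Ci R).
Variables (V : lmodType C) (h : V -> V -> C).
Hypothesis hD : forall x y y', h x (y + y') = h x y + h x y'.
Hypothesis hZ : forall z x y, h x (z *: y) = z * h x y.
Hypothesis hC : forall x y, h x y = Ci_conj (h y x).
Hypothesis hpos : forall x, Ci_ge0 (h x x).

Lemma psdDl x x' y : h (x + x') y = h x y + h x' y.
Proof. by rewrite hC hD Ci_conjD -!hC. Qed.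

Lemma psdZl z x y : h (z *: x) y = Ci_conj z * h x y.
Proof. by rewrite hC hZ Ci_conjM -hC. Qed.

Lemma psd_isotropic x y : h x x = 0 -> h x y = 0.
Proof.
move=> hx0; set c := h x y.
pose N := Ci_conj c * c; pose t := h y y + N.
apply: (Ci_normsq_cube_le0 (hpos y)); rewrite -/N.
have Nr : Ci_conj N = N by rewrite Ci_ge0_conj // Ci_ge0_normsq.
have tr : Ci_conj t = t.
  by rewrite Ci_ge0_conj // Ci_ge0D ?hpos ?Ci_ge0_normsq.
have hyx : h y x = Ci_conj c by rewrite hC.
have := hpos ((- t * c) *: x + N *: y).
rewrite hD !psdDl !hZ !psdZl hx0 hyx -/c Nr Ci_conjM.
have -> : Ci_conj (- t) = - t.
  by apply/eqP; rewrite -subr_eq0 opprK -{2}tr -Ci_conjD addNr Ci_conj0.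
rewrite -/N -/t.
set A := (X in Ci_ge0 X -> _); set A' := (X in _ -> Ci_ge0 X).
by have -> : A = A' by rewrite /A /A' /t /N; ring.
Qed.

End Psd.

Section StarAlgebras.
Variable R : realDomainType.
Local Notation C := (Ci R).

(* Not necessarily unital. *)
Record starAlgebra := StarAlgebra {
  sa_car :> lmodType C;
  amul : sa_car -> sa_car -> sa_car;
  star : sa_car -> sa_car;
  amulA : associative amul;
  amulDl : left_distributive amul +%R;
  amulDr : right_distributive amul +%R;
  amulZl : forall z a b, amul (z *: a) b = z *: amul a b;
  amulZr : forall z a b, amul a (z *: b) = z *: amul a b;
  starD : {morph star : a b / a + b};
  starZ : forall z a, star (z *: a) = Ci_conj z *: star a;
  starK : involutive star;
  starM : forall a b, star (amul a b) = amul (star b) (star a) }.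

Record unitalStarAlgebra := UnitalStarAlgebra {
  usa_alg :> starAlgebra;
  aone : usa_alg;
  amul1l : left_id aone (@amul usa_alg);
  amul1r : right_id aone (@amul usa_alg) }.

End StarAlgebras.

Arguments amul {R s}.
Arguments star {R s}.
Notation "a ** b" := (amul a b) (at level 40, left associativity).

Section StarAlgebraTheory.
Variables (R : realDomainType) (A : starAlgebra R).
Implicit Types a b : A.

Lemma amul0l a : 0 ** a = 0.
Proof. by apply: (addrI (0 ** a)); rewrite -amulDl !addr0. Qed.
Lemma amul0r a : a ** 0 = 0.
Proof. by apply: (addrI (a ** 0)); rewrite -amulDr !addr0. Qed.
Lemma star0 : star (0 : A) = 0.
Proof. by apply: (addrI (star 0)); rewrite -starD !addr0. Qed.
Lemma amul_suml (I : Type) (s : seq I) (F : I -> A) b :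
  (\sum_(i <- s) F i) ** b = \sum_(i <- s) (F i ** b).
Proof.
by elim: s => [|i s IH]; rewrite ?big_nil ?amul0l // !big_cons amulDl IH.
Qed.
Lemma amul_sumr (I : Type) (s : seq I) (F : I -> A) b :
  b ** (\sum_(i <- s) F i) = \sum_(i <- s) (b ** F i).
Proof.
by elim: s => [|i s IH]; rewrite ?big_nil ?amul0r // !big_cons amulDr IH.
Qed.
Lemma star_sum (I : Type) (s : seq I) (F : I -> A) :
  star (\sum_(i <- s) F i) = \sum_(i <- s) star (F i).
Proof.
by elim: s => [|i s IH]; rewrite ?big_nil ?star0 // !big_cons starD IH.
Qed.

End StarAlgebraTheory.

Section ScalarAlgebra.
Variable R : realDomainType.
Local Notation C := (Ci R).

Program Definition scalar_alg : starAlgebra R :=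
  @StarAlgebra R C^o (fun z w : C => z * w) (@Ci_conj R)
          _ _ _ _ _ _ _ _ _.
Next Obligation. exact: mulrA. Qed.
Next Obligation. exact: mulrDl. Qed.
Next Obligation. exact: mulrDr. Qed.
Next Obligation. by move=> z a b; rewrite -[LHS]mulrA. Qed.
Next Obligation. by move=> z a b; rewrite -[LHS]mulrCA. Qed.
Next Obligation. exact: Ci_conjD. Qed.
Next Obligation. by move=> z a; exact: Ci_conjM. Qed.
Next Obligation. exact: Ci_conjK. Qed.
Next Obligation. by move=> a b; rewrite Ci_conjM mulrC. Qed.

End ScalarAlgebra.

Section MatrixAlgebra.
Variables (R : realDomainType) (A : starAlgebra R) (n : nat).
Local Notation M := {ffun 'I_n * 'I_n -> A}.

Definition mat_mul (a b : M) : M :=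
  [ffun p => \sum_k (a (p.1, k) ** b (k, p.2))].
Definition mat_star (a : M) : M := [ffun p => star (a (p.2, p.1))].

Program Definition mat_alg : starAlgebra R :=
  @StarAlgebra R M mat_mul mat_star _ _ _ _ _ _ _ _ _.
Next Obligation.
move=> a b c; apply/ffunP => -[i j]; rewrite !ffunE /=.
under eq_bigr do rewrite ffunE /= amul_sumr.
under [RHS]eq_bigr do rewrite ffunE /= amul_suml.
by rewrite exchange_big; do 2!apply: eq_bigr => ? _; rewrite amulA.
Qed.
Next Obligation.
move=> a b c; apply/ffunP => -[i j]; rewrite !ffunE /= -big_split /=.
by apply: eq_bigr => k _; rewrite ffunE amulDl.
Qed.
Next Obligation.
move=> a b c; apply/ffunP => -[i j]; rewrite !ffunE /= -big_split /=.
by apply: eq_bigr => k _; rewrite ffunE amulDr.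
Qed.
Next Obligation.
move=> z a b; apply/ffunP => -[i j]; rewrite !ffunE /= scaler_sumr.
by apply: eq_bigr => k _; rewrite ffunE amulZl.
Qed.
Next Obligation.
move=> z a b; apply/ffunP => -[i j]; rewrite !ffunE /= scaler_sumr.
by apply: eq_bigr => k _; rewrite ffunE amulZr.
Qed.
Next Obligation. by move=> a b; apply/ffunP => -[i j]; rewrite !ffunE starD. Qed.
Next Obligation. by move=> z a; apply/ffunP => -[i j]; rewrite !ffunE starZ. Qed.
Next Obligation. by move=> a; apply/ffunP => -[i j]; rewrite !ffunE starK. Qed.
Next Obligation.
move=> a b; apply/ffunP => -[i j]; rewrite !ffunE /= star_sum.
by apply: eq_bigr => k _; rewrite !ffunE starM.
Qed.

End MatrixAlgebra.

Section Positivity.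
Variable R : realDomainType.
Local Notation C := (Ci R).

Definition positive (A : starAlgebra R) (f : A -> C) : Prop :=
  forall a : A, Ci_ge0 (f (star a ** a)).

Definition completely_positive (D : starAlgebra R) (X : Type)
    (g : X -> X -> D) : Prop :=
  forall (n : nat) (x : 'I_n -> X) (f : {scalar mat_alg D n}),
    positive f -> Ci_ge0 (f [ffun p => g (x p.1) (x p.2)]).

Lemma cp_gram (D : starAlgebra R) n (x : 'I_n -> D) (f : {scalar mat_alg D n}) :
  positive f -> Ci_ge0 (f [ffun p => star (x p.1) ** x p.2]).
Proof.
case: n x f => [|n] x f hf.
  have -> : [ffun p => star (x p.1) ** x p.2] = 0 :> mat_alg D 0.
    by apply/ffunP => -[[]].
  by rewrite linear0 Ci_ge00.
pose m : mat_alg D n.+1 := [ffun p => if p.1 == ord0 then x p.2 else 0].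
suff -> : [ffun p => star (x p.1) ** x p.2] = star m ** m by exact: hf.
apply/ffunP => -[i j]; rewrite !ffunE /= (bigD1 ord0) //= big1 => [|k hk].
  by rewrite !ffunE /= addr0.
by rewrite !ffunE /= (negPf hk) amul0r.
Qed.

Lemma psd_cp (V : lmodType C) (h : V -> V -> C) :
  (forall x y y', h x (y + y') = h x y + h x y') ->
  (forall z x y, h x (z *: y) = z * h x y) ->
  (forall x y, h x y = Ci_conj (h y x)) ->
  (forall x, Ci_ge0 (h x x)) ->
  @completely_positive (scalar_alg R) V h.
Proof.
move=> hD hZ hC hpos n b f hf.
have hDl := psdDl hD hC; have hZl := psdZl hZ hC.
have iso := psd_isotropic hD hZ hC hpos.
have hN x y : h x (- y) = - h x y by rewrite -scaleN1r hZ mulN1r.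
have hNl x y : h (- x) y = - h x y.
  apply/eqP; rewrite -subr_eq0 opprK -hDl addNr -(scale0r (0 : V)) hZl.
  by rewrite Ci_conj0 mul0r.
move: {2}(#|_|) (leqnn #|[set i | h (b i) (b i) != 0]|) => m.
elim: m b => [|m IH] b.
  rewrite leqn0 cards_eq0 => /eqP S0.
  have -> : [ffun p => h (b p.1) (b p.2)] = 0 :> mat_alg (scalar_alg R) n.
    apply/ffunP => -[i j]; rewrite !ffunE /= iso //.
    by apply/eqP; apply/negPn; move/setP/(_ i): S0; rewrite !inE => ->.
  by rewrite linear0 Ci_ge00.
move=> hS; have [S0|[i0]] := set_0Vmem [set i | h (b i) (b i) != 0].
  by apply: IH; rewrite S0 cards0.
rewrite inE => g0; set g := h (b i0) (b i0) in g0.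
have gr : Ci_conj g = g by rewrite Ci_ge0_conj ?hpos.
pose b' i := g *: b i - h (b i0) (b i) *: b i0.
have b'E i j : h (b' i) (b' j) =
    g * (g * h (b i) (b j)) - g * (Ci_conj (h (b i0) (b i)) * h (b i0) (b j)).
  rewrite /b' hD !hDl hN !hNl !hZ !hZl hN -/g gr !hZ -/g.
  by rewrite [h (b i) (b i0)]hC; ring.
have fb' : Ci_ge0 (f [ffun p => h (b' p.1) (b' p.2)]).
  apply: IH; rewrite -ltnS; apply: leq_trans hS; apply: proper_card.
  apply/properP; split.
    apply/subsetP => i; rewrite !inE; apply: contra => /eqP h0.
    by rewrite b'E h0 (hC (b i0)) (iso _ _ h0) Ci_conj0 !(mulr0, mul0r) subr0.
  exists i0; rewrite inE ?g0 // negbK b'E -/g gr.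
  by rewrite subrr.
pose G : mat_alg (scalar_alg R) n := [ffun p => h (b p.1) (b p.2)].
pose G' : mat_alg (scalar_alg R) n := [ffun p => h (b' p.1) (b' p.2)].
pose L : mat_alg (scalar_alg R) n := [ffun p =>
   star (h (b i0) (b p.1) : scalar_alg R) ** (h (b i0) (b p.2) : scalar_alg R)].
suff : Ci_ge0 (g * (g * (f G : C))).
  by do 2!move/(Ci_ge0_cancel (hpos (b i0)) g0).
have -> : g * (g * (f G : C)) = (f G' : C) + g * (f L : C).
  rewrite -!linearZ -linearD; congr (f _).
  apply/ffunP => -[i j]; rewrite !ffunE /= b'E.
  rewrite /GRing.scale /=; ring.
apply: Ci_ge0D => //; apply: Ci_ge0M; first exact: hpos.
exact: (@cp_gram (scalar_alg R) n (fun i => h (b i0) (b i)) f hf).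
Qed.

End Positivity.

Section QuotientModule.
Variables (C : comNzRingType) (M : lmodType C) (N : submodClosed M).

Let rpredN1 x : x \in N -> - x \in N.
Proof. by move=> hx; rewrite -scaleN1r rpredZ. Qed.

Definition qequiv (x y : M) := (x - y) \in N.

Lemma qequiv_is_equiv : equiv_class_of qequiv.
Proof.
split=> [x|x y|y x z]; rewrite /qequiv ?subrr ?rpred0 //.
  by apply/idP/idP => /rpredN1; rewrite opprB.
by move=> h1 h2; rewrite -[x](addrNK y) -addrA rpredD.
Qed.

Canonical qequiv_equiv := EquivRelPack qequiv_is_equiv.
Canonical qequiv_encModRel := defaultEncModRel qequiv.

Definition qmod := {eq_quot qequiv}.
HB.instance Definition _ := EqQuotient.on qmod.
HB.instance Definition _ := Choice.on qmod.

Definition qpi (x : M) : qmod := \pi_qmod x.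

Lemma qpiP x y : (qpi x = qpi y) <-> (x - y \in N).
Proof. by split=> [/eqP|h]; [|apply/eqP]; rewrite piE. Qed.

Lemma qpi_repr (x : qmod) : qpi (repr x) = x.
Proof. exact: reprK. Qed.

Lemma repr_qpi x : repr (qpi x) - x \in N.
Proof. by apply/qpiP; rewrite qpi_repr. Qed.

Let qadd (x y : qmod) := qpi (repr x + repr y).
Let qopp (x : qmod) := qpi (- repr x).
Let qscale (z : C) (x : qmod) := qpi (z *: repr x).

Let qaddE x y : qadd (qpi x) (qpi y) = qpi (x + y).
Proof. by apply/qpiP; rewrite opprD addrACA rpredD ?repr_qpi. Qed.
Let qoppE x : qopp (qpi x) = qpi (- x).
Proof. by apply/qpiP; rewrite -opprD rpredN1 ?repr_qpi. Qed.
Let qscaleE z x : qscale z (qpi x) = qpi (z *: x).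
Proof. by apply/qpiP; rewrite -scalerBr rpredZ ?repr_qpi. Qed.

Lemma qmod_addA : associative qadd.
Proof.
by move=> x y z; rewrite -[x]qpi_repr -[y]qpi_repr -[z]qpi_repr !qaddE addrA.
Qed.
Lemma qmod_addC : commutative qadd.
Proof. by move=> x y; rewrite -[x]qpi_repr -[y]qpi_repr !qaddE addrC. Qed.
Lemma qmod_add0 : left_id (qpi 0) qadd.
Proof. by move=> x; rewrite -[x]qpi_repr qaddE add0r. Qed.
Lemma qmod_addN : left_inverse (qpi 0) qopp qadd.
Proof. by move=> x; rewrite -[x]qpi_repr qoppE qaddE addNr. Qed.

HB.instance Definition _ :=
  GRing.isZmodule.Build qmod qmod_addA qmod_addC qmod_add0 qmod_addN.

Lemma qmod_scaleA z w x : qscale z (qscale w x) = qscale (z * w) x.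
Proof. by rewrite -[x]qpi_repr !qscaleE scalerA. Qed.
Lemma qmod_scale1 : left_id 1 qscale.
Proof. by move=> x; rewrite -[x]qpi_repr qscaleE scale1r. Qed.
Lemma qmod_scaleDr : right_distributive qscale +%R.
Proof.
move=> z x y; rewrite -[x]qpi_repr -[y]qpi_repr.
have qD a b : qpi a + qpi b = qpi (a + b) by exact: qaddE.
by rewrite qD !qscaleE qD scalerDr.
Qed.
Lemma qmod_scaleDl x : {morph qscale^~ x : z w / z + w}.
Proof.
move=> z w; rewrite -[x]qpi_repr !qscaleE scalerDl.
by symmetry; exact: qaddE.
Qed.

HB.instance Definition _ := GRing.Zmodule_isLmodule.Build C qmod
  qmod_scaleA qmod_scale1 qmod_scaleDr qmod_scaleDl.

Lemma qpiD x y : qpi (x + y) = qpi x + qpi y.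
Proof. by rewrite -qaddE. Qed.
Lemma qpiZ z x : qpi (z *: x) = z *: qpi x.
Proof. by rewrite -qscaleE. Qed.
Lemma qpi0 : qpi 0 = 0. Proof. by []. Qed.

End QuotientModule.

Section Span.
Variables (C : comNzRingType) (M : lmodType C) (S : M -> Prop).

Inductive in_span : M -> Prop :=
| in_span0 : in_span 0
| in_spanD z x y : S x -> in_span y -> in_span (z *: x + y).

Definition span : {pred M} := fun x => `[< in_span x >].

Lemma span_closed : submod_closed span.
Proof.
split=> [|z x y]; first exact/asboolP/in_span0.
move=> /asboolP hx /asboolP hy; apply/asboolP.
elim: {x} hx => [|w x x' Sx _ IH]; first by rewrite scaler0 add0r.
by rewrite scalerDr scalerA -addrA; exact: in_spanD.
Qed.

HB.instance Definition _ := GRing.isSubmodClosed.Build C M span span_closed.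

Lemma mem_span x : S x -> x \in span.
Proof.
move=> Sx; apply/asboolP; rewrite -[x]scale1r -[_ *: _]addr0.
exact/in_spanD/in_span0.
Qed.

End Span.

(* V (x)_K W for a right K-action [r] on V and a left K-action [l] on W, where V
   and W are also C-modules: the free C-module on V * W modulo C-bilinearity and
   K-balancing. *)
Section Tensor.
Variables (C : comNzRingType) (V W : lmodType C) (K : Type).
Variables (r : V -> K -> V) (l : K -> W -> W).
Local Notation F := {freeg (V * W)%type / C}.
Local Notation "<< v , w >>" := (Freeg [:: (1, (v, w))] : F).

Inductive tensor_rel : F -> Prop :=
| tensor_relDl v v' w :
    tensor_rel (<< v + v', w >> - (<< v, w >> + << v', w >>))
| tensor_relDr v w w' :
    tensor_rel (<< v, w + w' >> - (<< v, w >> + << v, w' >>))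
| tensor_relZl z v w : tensor_rel (<< z *: v, w >> - z *: << v, w >>)
| tensor_relZr z v w : tensor_rel (<< v, z *: w >> - z *: << v, w >>)
| tensor_relK k v w : tensor_rel (<< r v k, w >> - << v, l k w >>).

Definition tensor : lmodType C := qmod (span tensor_rel).

Definition tens (v : V) (w : W) : tensor := qpi (span tensor_rel) << v, w >>.

Lemma tensDl v v' w : tens (v + v') w = tens v w + tens v' w.
Proof. by rewrite -qpiD; apply/qpiP/mem_span; exact: tensor_relDl. Qed.
Lemma tensDr v w w' : tens v (w + w') = tens v w + tens v w'.
Proof. by rewrite -qpiD; apply/qpiP/mem_span; exact: tensor_relDr. Qed.
Lemma tensZl z v w : tens (z *: v) w = z *: tens v w.
Proof. by rewrite -qpiZ; apply/qpiP/mem_span; exact: tensor_relZl. Qed.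
Lemma tensZr z v w : tens v (z *: w) = z *: tens v w.
Proof. by rewrite -qpiZ; apply/qpiP/mem_span; exact: tensor_relZr. Qed.
Lemma tensK k v w : tens (r v k) w = tens v (l k w).
Proof. by apply/qpiP/mem_span; exact: tensor_relK. Qed.
Lemma tens0l w : tens 0 w = 0.
Proof. by apply: (addrI (tens 0 w)); rewrite -tensDl !addr0. Qed.

Lemma tensor_seq (t : tensor) :
  exists s : seq (V * W), t = \sum_(p <- s) tens p.1 p.2.
Proof.
rewrite -(qpi_repr t); move: (repr t) => {}t; rewrite -(freeg_sumE t).
elim: (dom t) => [|[v w] s [s' IH]].
  by exists [::]; rewrite !big_nil qpi0.
exists ((coeff (v, w) t *: v, w) :: s'); rewrite !big_cons qpiD IH /=.
congr (_ + _); rewrite tensZl -qpiZ; congr qpi.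
apply/eqP/freeg_eqP => p /=; rewrite coeffZ !coeffU.
by rewrite mul1r.
Qed.

Lemma tensor_ind (P : tensor -> Prop) :
  P 0 -> (forall x y, P x -> P y -> P (x + y)) ->
  (forall v w, P (tens v w)) -> forall t, P t.
Proof.
move=> P0 PD Pt t; have [s ->] := tensor_seq t.
by elim/big_ind: _.
Qed.

Lemma tensor_sum n (t : 'I_n -> tensor) :
  exists N (v : 'I_n -> 'I_N -> V) (w : 'I_n -> 'I_N -> W),
    forall i, t i = \sum_a tens (v i a) (w i a).
Proof.
have /choice[s hs] := fun i => tensor_seq (t i).
exists (\max_i size (s i))%N.
exists (fun i a => (nth (0, 0) (s i) a).1), (fun i a => (nth (0, 0) (s i) a).2).
move=> i; rewrite hs (big_nth (0, 0)) big_mkord.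
rewrite (big_ord_widen _ (fun a => tens (nth (0, 0) (s i) a).1
  (nth (0, 0) (s i) a).2) (@leq_bigmax _ (fun i => size (s i)) i)).
rewrite [LHS]big_mkcond /=.
apply: eq_bigr => a _; case: ltnP => // ha.
by rewrite nth_default //= tens0l.
Qed.

Section Lift.
Variables (U : lmodType C) (f : V -> W -> U).

Record balanced : Prop := Balanced {
  balDl : forall v v' w, f (v + v') w = f v w + f v' w;
  balDr : forall v w w', f v (w + w') = f v w + f v w';
  balZl : forall z v w, f (z *: v) w = z *: f v w;
  balZr : forall z v w, f v (z *: w) = z *: f v w;
  balK : forall v k w, f (r v k) w = f v (l k w) }.

(* The linear map [tens v w |-> f v w], for [f] balanced. *)
Definition tlift (t : tensor) : U := fglift (fun p => f p.1 p.2) (repr t).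

Hypothesis hf : balanced.
Let L (x : F) := fglift (fun p => f p.1 p.2) x.

Let LD x y : L (x + y) = L x + L y.
Proof.
have := lift_is_additive (fun p => f p.1 p.2) => hL.
have L0 : L 0 = 0 by rewrite /L -(subrr (0 : F)) hL subrr.
have LN z : L (- z) = - L z by rewrite /L -sub0r hL [fglift _ 0]L0 sub0r.
by rewrite -[y in LHS]opprK {1}/L hL [fglift _ (- y)]LN opprK.
Qed.
Let L0 : L 0 = 0.
Proof. by apply: (addrI (L 0)); rewrite -LD !addr0. Qed.
Let LN x : L (- x) = - L x.
Proof. by apply: (addIr (L x)); rewrite -LD !addNr L0. Qed.
Let L1 v w : L << v, w >> = f v w.
Proof. by rewrite /L liftU scale1r. Qed.

Let LZ z x : L (z *: x) = z *: L x.
Proof.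
rewrite -[x]freeg_sumE; elim: (dom x) => [|p s IH].
  by rewrite !big_nil scaler0 L0 scaler0.
rewrite !big_cons scalerDr !LD IH scalerDr; congr (_ + _).
have -> : z *: (Freeg [:: (coeff p x, p)] : F) = Freeg [:: (z * coeff p x, p)].
  by apply/eqP/freeg_eqP => q /=; rewrite coeffZ !coeffU mulrA.
by rewrite /L !liftU scalerA.
Qed.

Let Lspan x : x \in span tensor_rel -> L x = 0.
Proof.
case: hf => hDl hDr hZl hZr hK.
move/asboolP; elim=> {x} [|z x y hx _ IH]; first exact: L0.
rewrite LD LZ IH addr0.
suff -> : L x = 0 by rewrite scaler0.
by case: hx => *; rewrite LD LN ?LD ?LZ !L1 ?hDl ?hDr ?hZl ?hZr ?hK subrr.
Qed.

Let tliftE' x : tlift (qpi _ x) = L x.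
Proof.
apply/eqP; rewrite -subr_eq0; apply/eqP.
by rewrite -LN -LD; apply/Lspan/repr_qpi.
Qed.

Lemma tliftE v w : tlift (tens v w) = f v w.
Proof. by rewrite tliftE' L1. Qed.
Lemma tliftD x y : tlift (x + y) = tlift x + tlift y.
Proof. by rewrite -(qpi_repr x) -(qpi_repr y) -qpiD !tliftE' LD. Qed.
Lemma tliftZ z x : tlift (z *: x) = z *: tlift x.
Proof. by rewrite -(qpi_repr x) -qpiZ !tliftE' LZ. Qed.
Lemma tlift0 : tlift 0 = 0.
Proof. by apply: (addrI (tlift 0)); rewrite -tliftD !addr0. Qed.
Lemma tlift_sum (I : Type) (s : seq I) (G : I -> tensor) :
  tlift (\sum_(i <- s) G i) = \sum_(i <- s) tlift (G i).
Proof.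
by elim: s => [|i s IH]; rewrite ?big_nil ?tlift0 // !big_cons tliftD IH.
Qed.

End Lift.

Lemma eq_tlift (U : lmodType C) (f g : V -> W -> U) :
  (forall v w, f v w = g v w) -> tlift f = tlift g.
Proof. by move=> h; congr tlift; apply/funext => v; apply/funext => w. Qed.

End Tensor.

Section PreHilbert.
Variables (R : realDomainType) (D : starAlgebra R).
Local Notation C := (Ci R).

Record semiHilbert := SemiHilbert {
  sh_car :> lmodType C;
  ract : sh_car -> D -> sh_car;
  ip : sh_car -> sh_car -> D;
  ractDl : forall x y d, ract (x + y) d = ract x d + ract y d;
  ractDr : forall x d d', ract x (d + d') = ract x d + ract x d';
  ractZl : forall z x d, ract (z *: x) d = z *: ract x d;
  ractZr : forall z x d, ract x (z *: d) = z *: ract x d;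
  ractM : forall x d d', ract x (d ** d') = ract (ract x d) d';
  ipDr : forall x y y', ip x (y + y') = ip x y + ip x y';
  ipZr : forall z x y, ip x (z *: y) = z *: ip x y;
  ipM : forall x y d, ip x (ract y d) = ip x y ** d;
  ipC : forall x y, ip x y = star (ip y x);
  ip_cp : completely_positive ip }.

Record preHilbert := PreHilbert {
  ph_semi :> semiHilbert;
  ip_nondeg : forall x : ph_semi, (forall y, ip x y = 0) -> x = 0 }.

(* Between pre-Hilbert modules such a map is automatically C-linear and right
   D-linear. *)
Definition adjointable (H H' : semiHilbert) (T : H -> H') : Prop :=
  exists T' : H' -> H, forall x y, ip (T x) y = ip x (T' y).

Section Theory.
Variable H : semiHilbert.
Implicit Types x y : H.

Lemma ipDl x x' y : ip (x + x') y = ip x y + ip x' y.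
Proof. by rewrite ipC ipDr starD -!ipC. Qed.
Lemma ipZl z x y : ip (z *: x) y = Ci_conj z *: ip x y.
Proof. by rewrite ipC ipZr starZ -ipC. Qed.
Lemma ip0r x : ip x 0 = 0.
Proof. by apply: (addrI (ip x 0)); rewrite -ipDr !addr0. Qed.
Lemma ip0l y : ip 0 y = 0.
Proof. by rewrite ipC ip0r star0. Qed.
Lemma ipNl x y : ip (- x) y = - ip x y.
Proof. by apply: (addrI (ip x y)); rewrite -ipDl !subrr ip0l. Qed.
Lemma ip_sumr (I : Type) (s : seq I) (F : I -> H) x :
  ip x (\sum_(i <- s) F i) = \sum_(i <- s) ip x (F i).
Proof.
by elim: s => [|i s IH]; rewrite ?big_nil ?ip0r // !big_cons ipDr IH.
Qed.
Lemma ip_suml (I : Type) (s : seq I) (F : I -> H) x :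
  ip (\sum_(i <- s) F i) x = \sum_(i <- s) ip (F i) x.
Proof.
by elim: s => [|i s IH]; rewrite ?big_nil ?ip0l // !big_cons ipDl IH.
Qed.
Lemma ipMl x y d : ip (ract x d) y = star d ** ip x y.
Proof. by rewrite ipC ipM starM -ipC. Qed.

End Theory.

Lemma ip_ext (H : preHilbert) (x x' : H) :
  (forall y, ip x y = ip x' y) -> x = x'.
Proof.
move=> h; apply/eqP; rewrite -subr_eq0; apply/eqP/ip_nondeg => y.
by rewrite ipDl ipNl h subrr.
Qed.

Section AdjointableTheory.
Variables (H : semiHilbert) (H' : preHilbert) (T : H -> H').
Hypothesis hT : adjointable T.

Lemma adjointableD x y : T (x + y) = T x + T y.
Proof.
by have [T' h] := hT; apply: ip_ext => u; rewrite ipDl !h ipDl.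
Qed.
Lemma adjointableZ z x : T (z *: x) = z *: T x.
Proof.
by have [T' h] := hT; apply: ip_ext => u; rewrite ipZl !h ipZl.
Qed.
Lemma adjointable_ract x d : T (ract x d) = ract (T x) d.
Proof.
by have [T' h] := hT; apply: ip_ext => u; rewrite ipMl !h ipMl.
Qed.

End AdjointableTheory.

Definition degeneracy (S : semiHilbert) : {pred S} :=
  fun x => `[< forall y, ip x y = 0 >].
Arguments degeneracy S : clear implicits.

Lemma degeneracyP (S : semiHilbert) (x : S) :
  reflect (forall y, ip x y = 0) (x \in degeneracy S).
Proof. exact: asboolP. Qed.

Lemma degeneracy_closed S : submod_closed (degeneracy S).
Proof.
split=> [|z x y]; first by apply/degeneracyP => y; rewrite ip0l.
move=> /degeneracyP hx /degeneracyP hy; apply/degeneracyP => u.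
by rewrite ipDl ipZl hx hy scaler0 addr0.
Qed.

HB.instance Definition _ (S : semiHilbert) :=
  GRing.isSubmodClosed.Build C S (degeneracy S) (degeneracy_closed S).

(* The quotient by the degeneracy space, which may be presented as another
   submodule [N] with the same elements, such as the Gel'fand ideal below. *)
Section Separation.
Variables (S : semiHilbert) (N : submodClosed S).
Hypothesis hN : N =i degeneracy S.
Local Notation Q := (qmod N).

Lemma sep_ipl (x y : S) : ip (repr (qpi N x)) y = ip x y.
Proof.
apply/eqP; rewrite -subr_eq0 -ipNl -ipDl; apply/eqP.
by move: y; apply/degeneracyP; rewrite -hN repr_qpi.
Qed.
Lemma sep_ipr (x y : S) : ip x (repr (qpi N y)) = ip x y.
Proof. by rewrite ipC sep_ipl -ipC. Qed.
Lemma sep_ext (x y : S) : (forall u, ip x u = ip y u) -> qpi N x = qpi N y.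
Proof.
move=> h; apply/qpiP; rewrite hN; apply/degeneracyP => u.
by rewrite ipDl ipNl h subrr.
Qed.

Let qract (x : Q) d : Q := qpi N (ract (repr x) d).
Let qip (x y : Q) : D := ip (repr x) (repr y).

Let qractE x d : qract (qpi N x) d = qpi N (ract x d).
Proof. by apply: sep_ext => u; rewrite !ipMl sep_ipl. Qed.
Let qipE x y : qip (qpi N x) (qpi N y) = ip x y.
Proof. by rewrite /qip sep_ipl sep_ipr. Qed.

Program Definition sep_semi : semiHilbert :=
  @SemiHilbert Q qract qip _ _ _ _ _ _ _ _ _ _.
Next Obligation.
move=> x y d; rewrite -(qpi_repr x) -(qpi_repr y).
by rewrite -qpiD !qractE ractDl qpiD.
Qed.
Next Obligation. by move=> x d d'; rewrite -(qpi_repr x) !qractE ractDr qpiD. Qed.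
Next Obligation.
by move=> z x d; rewrite -(qpi_repr x) -qpiZ !qractE ractZl qpiZ.
Qed.
Next Obligation. by move=> z x d; rewrite -(qpi_repr x) !qractE ractZr qpiZ. Qed.
Next Obligation. by move=> x d d'; rewrite -(qpi_repr x) !qractE ractM. Qed.
Next Obligation.
move=> x y y'; rewrite -(qpi_repr x) -(qpi_repr y) -(qpi_repr y').
by rewrite -qpiD !qipE ipDr.
Qed.
Next Obligation.
by move=> z x y; rewrite -(qpi_repr x) -(qpi_repr y) -qpiZ !qipE ipZr.
Qed.
Next Obligation.
by move=> x y d; rewrite -(qpi_repr x) -(qpi_repr y) qractE !qipE ipM.
Qed.
Next Obligation. by move=> x y; rewrite /qip ipC. Qed.
Next Obligation.
by move=> n x f hf; exact: (@ip_cp S n (fun i => repr (x i)) f hf).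
Qed.

Program Definition sepN : preHilbert := @PreHilbert sep_semi _.
Next Obligation.
move=> x hx; rewrite -(qpi_repr x) -(qpi0 N); apply: sep_ext => u.
by rewrite ip0l -(sep_ipr _ u); exact: (hx (qpi N u)).
Qed.

Definition sepN_pi (x : S) : sepN := qpi N x.

Lemma sepN_surj (x : sepN) : sepN_pi (repr (x : Q)) = x.
Proof. exact: qpi_repr. Qed.
Lemma sepN_ip x y : ip (sepN_pi x) (sepN_pi y) = ip x y.
Proof. exact: qipE. Qed.
Lemma sepN_ract x d : ract (sepN_pi x) d = sepN_pi (ract x d).
Proof. exact: qractE. Qed.
Lemma sepN_ext x y : (forall u, ip x u = ip y u) -> sepN_pi x = sepN_pi y.
Proof. exact: sep_ext. Qed.
Lemma sepN_D x y : sepN_pi (x + y) = sepN_pi x + sepN_pi y.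
Proof. exact: qpiD. Qed.
Lemma sepN_Z z x : sepN_pi (z *: x) = z *: sepN_pi x.
Proof. exact: qpiZ. Qed.

End Separation.

Definition sep (S : semiHilbert) : preHilbert :=
  @sepN S (degeneracy S) (fun=> erefl).

Definition sep_pi (S : semiHilbert) (x : S) : sep S := sepN_pi (fun=> erefl) x.

Lemma sep_surj (S : semiHilbert) (x : sep S) : exists y, x = sep_pi y.
Proof. by exists (repr (x : qmod (degeneracy S))); rewrite [RHS]sepN_surj. Qed.

Definition sepN_map (S S' : semiHilbert) (N : submodClosed S)
    (N' : submodClosed S') (hN : N =i degeneracy S) (hN' : N' =i degeneracy S')
    (T : S -> S') (x : sepN hN) : sepN hN' :=
  sepN_pi hN' (T (repr (x : qmod N))).

Lemma sepN_mapE S S' N N' hN hN' T x : @adjointable S S' T ->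
  @sepN_map S S' N N' hN hN' T (sepN_pi hN x) = sepN_pi hN' (T x).
Proof.
by case=> T' hT; apply: sepN_ext => u; rewrite !hT; exact: sep_ipl.
Qed.

Lemma sepN_map_adj S S' N N' hN hN' T T' :
  (forall x y, ip (T x) y = ip x (T' y)) ->
  forall x y, ip (@sepN_map S S' N N' hN hN' T x) y =
              ip x (@sepN_map S' S N' N hN' hN T' y).
Proof.
move=> hT x y; rewrite -(sepN_surj x) -(sepN_surj y).
have aT : adjointable T by exists T'.
have aT' : adjointable T' by exists T => u v; rewrite ipC -hT -ipC.
by rewrite !sepN_mapE // !sepN_ip; exact: hT.
Qed.

End PreHilbert.

Arguments ract {R D s}.
Arguments ip {R D s}.
Arguments sep_pi {R D} S x.
Arguments sepN_map {R D S S' N N'} hN hN' T x.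
Arguments degeneracy {R D} S _.

Section Representations.
Variables (R : realDomainType) (A D : starAlgebra R).
Local Notation C := (Ci R).

(* [lact_star] makes every [lact a] adjointable with adjoint [lact (star a)];
   [lact_nondeg] is the condition A.H = H. *)
Record rep := Rep {
  rep_mod :> preHilbert D;
  lact : A -> rep_mod -> rep_mod;
  lactDl : forall a b x, lact (a + b) x = lact a x + lact b x;
  lactZl : forall z a x, lact (z *: a) x = z *: lact a x;
  lactM : forall a b x, lact (a ** b) x = lact a (lact b x);
  lact_star : forall a x y, ip (lact a x) y = ip x (lact (star a) y);
  lact_nondeg : forall x, exists s : seq (A * rep_mod),
    x = \sum_(p <- s) lact p.1 p.2 }.

Section Theory.
Variable H : rep.
Implicit Types (x y : H) (a : A).

Lemma lact_adj a : adjointable (@lact H a).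
Proof. by exists (@lact H (star a)) => x y; exact: lact_star. Qed.
Lemma lactDr a x y : lact a (x + y) = lact a x + lact a y.
Proof. exact/adjointableD/lact_adj. Qed.
Lemma lactZr z a x : lact a (z *: x) = z *: lact a x.
Proof. exact/adjointableZ/lact_adj. Qed.
Lemma lact_ract a x d : lact a (ract x d) = ract (lact a x) d.
Proof. exact/adjointable_ract/lact_adj. Qed.
Lemma lact0l x : lact 0 x = 0.
Proof. by apply: (addrI (lact 0 x)); rewrite -lactDl !addr0. Qed.
Lemma lact_suml (I : Type) (s : seq I) (F : I -> A) x :
  lact (\sum_(i <- s) F i) x = \sum_(i <- s) lact (F i) x.
Proof.
by elim: s => [|i s IH]; rewrite ?big_nil ?lact0l // !big_cons lactDl IH.
Qed.

End Theory.

Record rep_hom (H H' : rep) := RepHom {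
  rh_fun :> H -> H';
  rh_adj : adjointable rh_fun;
  rh_lact : forall a x, rh_fun (lact a x) = lact a (rh_fun x) }.

Lemma rep_hom_eq (H H' : rep) (S T : rep_hom H H') :
  (forall x, S x = T x) -> S = T.
Proof.
case: S T => [S hS hS'] [T hT hT'] /= /funext E.
by case: T / E hT hT' => *; congr RepHom; exact: Prop_irrelevance.
Qed.

Program Definition rep_id (H : rep) : rep_hom H H :=
  @RepHom H H (fun x => x) _ _.
Next Obligation. by move=> H; exists (fun x => x). Qed.
Next Obligation. by []. Qed.

Program Definition rep_comp (H H' H'' : rep) (S : rep_hom H' H'')
  (T : rep_hom H H') : rep_hom H H'' := @RepHom H H'' (fun x => S (T x)) _ _.
Next Obligation.
move=> H H' H'' S T; have [S' hS] := rh_adj S; have [T' hT] := rh_adj T.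
by exists (fun y => T' (S' y)) => x y; rewrite hS hT.
Qed.
Next Obligation. by move=> H H' H'' S T a x; rewrite /= !rh_lact. Qed.

Lemma rh_adj_lact (H H' : rep) (T : rep_hom H H') T' :
  (forall x y, ip (T x) y = ip x (T' y)) ->
  forall a y, T' (lact a y) = lact a (T' y).
Proof.
move=> hT a y; apply: ip_ext => x; rewrite ipC -hT lact_star [RHS]ipC.
by rewrite -hT rh_lact lact_star starK.
Qed.

End Representations.

Arguments lact {R A D r}.

Record category := Category {
  cat_ob :> Type;
  cat_hom : cat_ob -> cat_ob -> Type;
  cat_id : forall X, cat_hom X X;
  cat_comp : forall X Y Z, cat_hom Y Z -> cat_hom X Y -> cat_hom X Z;
  cat_compA : forall X Y Z W (h : cat_hom Z W) (g : cat_hom Y Z)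
    (f : cat_hom X Y), cat_comp h (cat_comp g f) = cat_comp (cat_comp h g) f;
  cat_idl : forall X Y (f : cat_hom X Y), cat_comp (cat_id Y) f = f;
  cat_idr : forall X Y (f : cat_hom X Y), cat_comp f (cat_id X) = f }.

Arguments cat_hom {c}.
Arguments cat_id {c}.
Arguments cat_comp {c X Y Z}.

Record functor (X Y : category) := Functor {
  fun_ob :> X -> Y;
  fun_hom : forall a b, cat_hom a b -> cat_hom (fun_ob a) (fun_ob b);
  fun_id : forall a, fun_hom (cat_id a) = cat_id (fun_ob a);
  fun_comp : forall a b c (g : cat_hom b c) (f : cat_hom a b),
    fun_hom (cat_comp g f) = cat_comp (fun_hom g) (fun_hom f) }.

Arguments fun_hom {X Y} f {a b} _ : rename.

Definition is_iso (X : category) (a b : X) (f : cat_hom a b) : Prop :=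
  exists g : cat_hom b a, cat_comp g f = cat_id a /\ cat_comp f g = cat_id b.

Definition naturally_equivalent (X Y : category) (F G : functor X Y) : Prop :=
  exists eta : forall a, cat_hom (F a) (G a),
    (forall a, is_iso (eta a)) /\
    (forall a b (f : cat_hom a b),
       cat_comp (eta b) (fun_hom F f) = cat_comp (fun_hom G f) (eta a)).

Program Definition repCat (R : realDomainType) (A D : starAlgebra R) : category :=
  @Category (rep A D) (@rep_hom R A D) (@rep_id R A D)
          (@rep_comp R A D) _ _ _.
Next Obligation.
move=> R A D.
by move=> *; exact: rep_hom_eq.
Qed.
Next Obligation.
move=> R A D.
by move=> *; exact: rep_hom_eq.
Qed.
Next Obligation.
move=> R A D.
by move=> *; exact: rep_hom_eq.
Qed.

(* Tensor product of C-modules; the balancing condition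
   (z v) (x) w = v (x) (z w) is then implied by C-bilinearity. *)
Section TensorC.
Variables (C : comNzRingType) (V W : lmodType C).

Definition tensorC : lmodType C :=
  tensor (fun (v : V) (z : C) => z *: v) (fun z (w : W) => z *: w).
Definition tensC (v : V) (w : W) : tensorC := tens _ _ v w.
Definition tliftC (U : lmodType C) (f : V -> W -> U) : tensorC -> U :=
  tlift f.

Definition bilinearC (U : lmodType C) (f : V -> W -> U) : Prop :=
  balanced (fun (v : V) (z : C) => z *: v) (fun z (w : W) => z *: w) f.

Lemma balancedC (U : lmodType C) (f : V -> W -> U) :
  (forall v v' w, f (v + v') w = f v w + f v' w) ->
  (forall v w w', f v (w + w') = f v w + f v w') ->
  (forall z v w, f (z *: v) w = z *: f v w) ->
  (forall z v w, f v (z *: w) = z *: f v w) ->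
  bilinearC f.
Proof. by move=> hDl hDr hZl hZr; split=> // z v w; rewrite hZl hZr. Qed.

End TensorC.

(* [U] with scalars acting through conjugation, to lift antilinear maps. *)
Definition conjmod (R : realDomainType) (U : lmodType (Ci R)) : Type := U.

Section ConjMod.
Variables (R : realDomainType) (U : lmodType (Ci R)).
HB.instance Definition _ := GRing.Zmodule.on (conjmod U).

Let cscale (z : Ci R) (u : conjmod U) : conjmod U := Ci_conj z *: (u : U).

Lemma conjmodA z w u : cscale z (cscale w u) = cscale (z * w) u.
Proof. by rewrite /cscale scalerA Ci_conjM. Qed.
Lemma conjmod1 : left_id 1 cscale.
Proof. by move=> u; rewrite /cscale Ci_conj1 scale1r. Qed.
Lemma conjmodDr : right_distributive cscale +%R.
Proof. by move=> z u v; rewrite /cscale scalerDr. Qed.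
Lemma conjmodDl u : {morph cscale^~ u : z w / z + w}.
Proof. by move=> z w; rewrite /cscale Ci_conjD scalerDl. Qed.

HB.instance Definition _ := GRing.Zmodule_isLmodule.Build (Ci R) (conjmod U)
  conjmodA conjmod1 conjmodDr conjmodDl.

Lemma conjmodE z u : z *: (u : conjmod U) = Ci_conj z *: (u : U) :> U.
Proof. by []. Qed.

End ConjMod.

Section TensorAlgebra.
Variables (R : realDomainType) (B A : starAlgebra R).
Local Notation T := (tensorC B A).

Let tmul (s t : T) : T :=
  tliftC (fun b a => tliftC (fun b' a' => tensC (b ** b') (a ** a')) t) s.
Let tstar (t : T) : T :=
  tliftC (U := conjmod T) (fun b a => tensC (star b) (star a)) t.

Let bal1 b a : bilinearC (fun b' a' => tensC (b ** b') (a ** a') : T).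
Proof.
apply: balancedC => *; rewrite /tensC.
- by rewrite amulDr tensDl.
- by rewrite amulDr tensDr.
- by rewrite amulZr tensZl.
- by rewrite amulZr tensZr.
Qed.

Let tmul1 b a b' a' :
  tliftC (fun b' a' => tensC (b ** b') (a ** a') : T) (tensC b' a')
  = tensC (b ** b') (a ** a').
Proof. by rewrite [LHS](tliftE (bal1 b a)). Qed.

Let bal2 t : bilinearC
  (fun b a => tliftC (fun b' a' => tensC (b ** b') (a ** a') : T) t).
Proof.
apply: balancedC => [b b' a|b a a'|z b a|z b a]; move: t;
  apply: tensor_ind => [|x y hx hy|v w].
all: try by rewrite /tliftC !(tlift0 (bal1 _ _)) ?addr0 ?scaler0.
all: try by move: hx hy; rewrite /tliftC !(tliftD (bal1 _ _)) => -> ->;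
  rewrite ?scalerDr // addrACA.
all: rewrite /tliftC !(tliftE (bal1 _ _)) /tensC.
- by rewrite amulDl tensDl.
- by rewrite amulDl tensDr.
- by rewrite amulZl tensZl.
- by rewrite amulZl tensZr.
Qed.

Let bal3 : bilinearC
  (fun b a => tensC (star b) (star a) : conjmod T).
Proof.
apply: balancedC => *; rewrite /tensC.
- by rewrite starD tensDl.
- by rewrite starD tensDr.
- by rewrite starZ tensZl.
- by rewrite starZ tensZr.
Qed.

Let tmulL b a t : tmul (tens _ _ b a) t
  = tliftC (fun b' a' => tensC (b ** b') (a ** a') : T) t.
Proof. exact: (tliftE (bal2 t)). Qed.
Let tmulE b a b' a' :
  tmul (tensC b a) (tensC b' a') = tensC (b ** b') (a ** a').
Proof. by rewrite [LHS]tmulL tmul1. Qed.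
Let tmulDl s s' t : tmul (s + s') t = tmul s t + tmul s' t.
Proof. exact: (tliftD (bal2 t)). Qed.
Let tmulZl z s t : tmul (z *: s) t = z *: tmul s t.
Proof. exact: (tliftZ (bal2 t)). Qed.
Let tmul0l t : tmul 0 t = 0.
Proof. exact: (tlift0 (bal2 t)). Qed.
Let tmulDr s t t' : tmul s (t + t') = tmul s t + tmul s t'.
Proof.
elim/tensor_ind: s => [|x y hx hy|b a]; first by rewrite !tmul0l addr0.
  by rewrite !tmulDl hx hy addrACA.
rewrite !tmulL; exact: (tliftD (bal1 b a)).
Qed.
Let tmulZr z s t : tmul s (z *: t) = z *: tmul s t.
Proof.
elim/tensor_ind: s => [|x y hx hy|b a]; first by rewrite !tmul0l scaler0.
  by rewrite !tmulDl hx hy scalerDr.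
rewrite !tmulL; exact: (tliftZ (bal1 b a)).
Qed.
Let tmul0r s : tmul s 0 = 0.
Proof. by apply: (addrI (tmul s 0)); rewrite -tmulDr !addr0. Qed.
Let tstarE b a : tstar (tensC b a) = tensC (star b) (star a).
Proof. by rewrite /tstar [LHS](tliftE bal3). Qed.
Let tstarD : {morph tstar : s t / s + t}.
Proof. move=> s t; exact: (tliftD bal3). Qed.
Let tstarZ z s : tstar (z *: s) = Ci_conj z *: tstar s.
Proof. exact: (tliftZ bal3). Qed.
Let tstar0 : tstar 0 = 0.
Proof. exact: (tlift0 bal3). Qed.

Program Definition tensor_alg : starAlgebra R :=
  @StarAlgebra R T tmul tstar _ tmulDl tmulDr tmulZl tmulZr
  tstarD tstarZ _ _.
Next Obligation.
move=> s t u; elim/tensor_ind: s => [|x y hx hy|b a].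
  by rewrite !tmul0l.
by rewrite !tmulDl hx hy.
elim/tensor_ind: t => [|x y hx hy|b' a'].
  by rewrite ?(tmul0l, tmul0r).
by rewrite !(tmulDl, tmulDr) hx hy.
elim/tensor_ind: u => [|x y hx hy|b'' a'']; first by rewrite !tmul0r.
  by rewrite !tmulDr hx hy.
by rewrite !tmulE !amulA.
Qed.
Next Obligation.
move=> s; elim/tensor_ind: s => [|x y hx hy|b a]; first by rewrite !tstar0.
  by rewrite !tstarD hx hy.
by rewrite !tstarE !starK.
Qed.
Next Obligation.
move=> s t; elim/tensor_ind: s => [|x y hx hy|b a].
  by rewrite tmul0l tstar0 tmul0r.
by rewrite tmulDl !tstarD tmulDr hx hy.
elim/tensor_ind: t => [|x y hx hy|b' a'].
  by rewrite tmul0r tstar0 tmul0l.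
by rewrite tmulDr !tstarD tmulDl hx hy.
by rewrite !(tmulE, tstarE) !starM.
Qed.

Lemma tensor_alg_mul b a b' a' :
  amul (tensC b a : tensor_alg) (tensC b' a' : tensor_alg)
  = tensC (b ** b') (a ** a').
Proof. exact: tmulE. Qed.
Lemma tensor_alg_star b a :
  star (tensC b a : tensor_alg) = tensC (star b) (star a).
Proof. exact: tstarE. Qed.

End TensorAlgebra.

Program Definition tensor_ualg (R : realDomainType) (B A : unitalStarAlgebra R) :
  unitalStarAlgebra R :=
  @UnitalStarAlgebra R (tensor_alg B A) (tensC (aone B) (aone A)) _ _.
Next Obligation.
move=> R B A.
elim/tensor_ind => [|x y hx hy|b a]; first by rewrite amul0r.
  by rewrite amulDr hx hy.
by rewrite [LHS]tensor_alg_mul !amul1l.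
Qed.
Next Obligation.
move=> R B A.
elim/tensor_ind => [|x y hx hy|b a]; first by rewrite amul0l.
  by rewrite amulDl hx hy.
by rewrite [LHS]tensor_alg_mul !amul1r.
Qed.

(* A D-valued semi-inner product on the tensor product of V and W, given by its
   values [tf v w v' w'] = < v (x) w, v' (x) w' > on elementary tensors.  The
   right D-action is that of W. *)
Section TensorForm.
Variables (R : realDomainType) (D : starAlgebra R).
Local Notation C := (Ci R).
Variables (V : lmodType C) (K : Type) (r : V -> K -> V).
Variables (W : semiHilbert D) (l : K -> W -> W).

Record tensorForm := TensorForm {
  tf :> V -> W -> V -> W -> D;
  tf_bal : forall v w, balanced r l (tf v w);
  tfC : forall v w v' w', tf v w v' w' = star (tf v' w' v w);
  tfM : forall v w v' w' d, tf v w v' (ract w' d) = tf v w v' w' ** d;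
  tf_l : forall k w d, l k (ract w d) = ract (l k w) d;
  tf_cp : forall n N (v : 'I_n -> 'I_N -> V) (w : 'I_n -> 'I_N -> W)
    (f : {scalar mat_alg D n}), positive f ->
    Ci_ge0 (f [ffun p =>
      \sum_a \sum_b tf (v p.1 a) (w p.1 a) (v p.2 b) (w p.2 b)]) }.

Variable g : tensorForm.
Local Notation T := (tensor r l).

Let tip (t u : T) : D :=
  tlift (U := conjmod D) (fun v w => tlift (g v w) u) t.
Let tract (t : T) (d : D) : T := tlift (fun v w => tens r l v (ract w d)) t.

Let bal1 (u : T) : balanced r l (fun v w => tlift (g v w) u : conjmod D).
Proof.
split=> [v v' w|v w w'|z v w|z v w|v k w]; move: u;
  apply: tensor_ind => [|x y hx hy|x y].
all: try by rewrite !(tlift0 (tf_bal _ _ _)) ?addr0 ?scaler0.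
all: try by rewrite !(tliftD (tf_bal _ _ _)) hx hy ?scalerDr // addrACA.
all: rewrite !(tliftE (tf_bal _ _ _)) ?conjmodE 1?tfC
  ?(balDl (tf_bal g _ _)) ?(balDr (tf_bal g _ _)) ?(balZl (tf_bal g _ _))
  ?(balZr (tf_bal g _ _)) ?(balK (tf_bal g _ _)) ?starD ?starZ -?tfC //.
Qed.

Let tipE v w v' w' : tip (tens r l v w) (tens r l v' w') = g v w v' w'.
Proof. by rewrite /tip (tliftE (bal1 _)) (tliftE (tf_bal g _ _)). Qed.
Let tipDl s s' t : tip (s + s') t = tip s t + tip s' t.
Proof. exact: (tliftD (bal1 t)). Qed.
Let tip0l t : tip 0 t = 0.
Proof. exact: (tlift0 (bal1 t)). Qed.
Let tipDr s t t' : tip s (t + t') = tip s t + tip s t'.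
Proof.
elim/tensor_ind: s => [|x y hx hy|v w]; first by rewrite !tip0l addr0.
  by rewrite !tipDl hx hy addrACA.
rewrite /tip !(tliftE (bal1 _)); exact: (tliftD (tf_bal g v w)).
Qed.
Let tipZr z s t : tip s (z *: t) = z *: tip s t.
Proof.
elim/tensor_ind: s => [|x y hx hy|v w]; first by rewrite !tip0l scaler0.
  by rewrite !tipDl hx hy scalerDr.
rewrite /tip !(tliftE (bal1 _)); exact: (tliftZ (tf_bal g v w)).
Qed.
Let tip0r s : tip s 0 = 0.
Proof. by apply: (addrI (tip s 0)); rewrite -tipDr !addr0. Qed.
Let tip_suml (I : Type) (s : seq I) (F : I -> T) t :
  tip (\sum_(i <- s) F i) t = \sum_(i <- s) tip (F i) t.
Proof.
by elim: s => [|i s IH]; rewrite ?big_nil ?tip0l // !big_cons tipDl IH.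
Qed.
Let tip_sumr (I : Type) (s : seq I) (F : I -> T) t :
  tip t (\sum_(i <- s) F i) = \sum_(i <- s) tip t (F i).
Proof.
by elim: s => [|i s IH]; rewrite ?big_nil ?tip0r // !big_cons tipDr IH.
Qed.

Let bal2 d : balanced r l (fun v w => tens r l v (ract w d)).
Proof.
split=> *.
- by rewrite tensDl.
- by rewrite ractDl tensDr.
- by rewrite tensZl.
- by rewrite ractZl tensZr.
- by rewrite tensK (tf_l g).
Qed.
Let tractE v w d : tract (tens r l v w) d = tens r l v (ract w d).
Proof. exact: (tliftE (bal2 d)). Qed.
Let tractDl t t' d : tract (t + t') d = tract t d + tract t' d.
Proof. exact: (tliftD (bal2 d)). Qed.
Let tractZl z t d : tract (z *: t) d = z *: tract t d.
Proof. exact: (tliftZ (bal2 d)). Qed.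
Let tract0 d : tract 0 d = 0.
Proof. exact: (tlift0 (bal2 d)). Qed.

Program Definition tensor_semi : semiHilbert D :=
  @SemiHilbert R D T tract tip tractDl _ tractZl _ _ tipDr tipZr _ _ _.
Next Obligation.
move=> t d d'; elim/tensor_ind: t => [|x y hx hy|v w].
+ by rewrite !tract0 addr0.
+ by rewrite !tractDl hx hy addrACA.
+ by rewrite !tractE ractDr tensDr.
Qed.
Next Obligation.
move=> z t d; elim/tensor_ind: t => [|x y hx hy|v w].
+ by rewrite !tract0 scaler0.
+ by rewrite !tractDl hx hy scalerDr.
+ by rewrite !tractE ractZr tensZr.
Qed.
Next Obligation.
move=> t d d'; elim/tensor_ind: t => [|x y hx hy|v w].
+ by rewrite !tract0.
+ by rewrite !tractDl hx hy.
+ by rewrite !tractE ractM.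
Qed.
Next Obligation.
move=> s t d; elim/tensor_ind: s => [|x y hx hy|v w].
+ by rewrite !tip0l amul0l.
+ by rewrite !tipDl hx hy amulDl.
elim/tensor_ind: t => [|x y hx hy|v' w'].
+ by rewrite tract0 tip0r amul0l.
+ by rewrite tractDl !tipDr hx hy amulDl.
+ by rewrite tractE !tipE tfM.
Qed.
Next Obligation.
move=> s t; elim/tensor_ind: s => [|x y hx hy|v w].
+ by rewrite tip0l tip0r star0.
+ by rewrite tipDl tipDr starD hx hy.
elim/tensor_ind: t => [|x y hx hy|v' w'].
+ by rewrite tip0l tip0r star0.
+ by rewrite tipDl tipDr starD hx hy.
+ by rewrite !tipE tfC.
Qed.
Next Obligation.
move=> n t f hf; have [N [v [w h]]] := tensor_sum t.
have -> : [ffun p => tip (t p.1) (t p.2)] = [ffun p =>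
    \sum_a \sum_b g (v p.1 a) (w p.1 a) (v p.2 b) (w p.2 b)].
  apply/ffunP => -[i j]; rewrite !ffunE /= !h tip_suml.
  apply: eq_bigr => a _; rewrite tip_sumr; apply: eq_bigr => b _.
  exact: tipE.
exact: tf_cp.
Qed.

Lemma tensor_ipE v w v' w' :
  ip (tens r l v w : tensor_semi) (tens r l v' w') = g v w v' w'.
Proof. exact: tipE. Qed.
Lemma tensor_ractE v w d :
  ract (tens r l v w : tensor_semi) d = tens r l v (ract w d).
Proof. exact: tractE. Qed.

End TensorForm.

Section TensorMap.
Variables (C : comNzRingType) (K : Type).
Variables (V V' W W' : lmodType C).
Variables (r : V -> K -> V) (l : K -> W -> W).
Variables (r' : V' -> K -> V') (l' : K -> W' -> W').

Definition tmap (f : V -> V') (h : W -> W') : tensor r l -> tensor r' l' :=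
  tlift (fun v w => tens r' l' (f v) (h w)).

Record tensorable (f : V -> V') (h : W -> W') : Prop := Tensorable {
  tm_fD : forall v v', f (v + v') = f v + f v';
  tm_hD : forall w w', h (w + w') = h w + h w';
  tm_fZ : forall z v, f (z *: v) = z *: f v;
  tm_hZ : forall z w, h (z *: w) = z *: h w;
  tm_f : forall v k, f (r v k) = r' (f v) k;
  tm_h : forall k w, h (l k w) = l' k (h w) }.

Variables (f : V -> V') (h : W -> W').
Hypothesis fh : tensorable f h.

Let bal : balanced r l (fun v w => tens r' l' (f v) (h w)).
Proof.
case: fh => *; split=> *.
- by rewrite -tensDl; congr tens.
- by rewrite -tensDr; congr tens.
- by rewrite -tensZl; congr tens.
- by rewrite -tensZr; congr tens.
- by rewrite (tm_f fh) (tm_h fh) tensK.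
Qed.

Lemma tmapE v w : tmap f h (tens r l v w) = tens r' l' (f v) (h w).
Proof. exact: (tliftE bal). Qed.
Lemma tmapD s t : tmap f h (s + t) = tmap f h s + tmap f h t.
Proof. exact: (tliftD bal). Qed.
Lemma tmapZ z t : tmap f h (z *: t) = z *: tmap f h t.
Proof. exact: (tliftZ bal). Qed.
Lemma tmap0 : tmap f h 0 = 0.
Proof. exact: (tlift0 bal). Qed.

End TensorMap.

Lemma tmap_id (C : comNzRingType) (K : Type) (V W : lmodType C)
  (r : V -> K -> V) (l : K -> W -> W) (t : tensor r l) :
  tmap r l (fun v => v) (fun w => w) t = t.
Proof.
have able : tensorable r l r l (fun v => v) (fun w => w) by [].
elim/tensor_ind: t => [|x y hx hy|v w]; first exact: (tmap0 able).
  by rewrite (tmapD able) hx hy.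
exact: (tmapE able).
Qed.

Lemma tmap_comp (C : comNzRingType) (K : Type) (V W W' W'' : lmodType C)
  (r : V -> K -> V) (l : K -> W -> W) (l' : K -> W' -> W')
  (l'' : K -> W'' -> W'') (h : W -> W') (h' : W' -> W'') (t : tensor r l) :
  tensorable r l r l' (fun v => v) h ->
  tensorable r l' r l'' (fun v => v) h' ->
  tmap r l'' (fun v => v) (fun w => h' (h w)) t
  = tmap r l'' (fun v => v) h' (tmap r l' (fun v => v) h t).
Proof.
move=> able able'.
have able'' : tensorable r l r l'' (fun v => v) (fun w => h' (h w)).
  split=> // *.
  - by rewrite (tm_hD able) (tm_hD able').
  - by rewrite (tm_hZ able) (tm_hZ able').
  - by rewrite (tm_h able) (tm_h able').
elim/tensor_ind: t => [|x y hx hy|v w].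
- by rewrite (tmap0 able) (tmap0 able') (tmap0 able'').
- by rewrite (tmapD able) (tmapD able') (tmapD able'') hx hy.
- by rewrite (tmapE able) (tmapE able') (tmapE able'').
Qed.

Lemma tmap_adj (R : realDomainType) (D : starAlgebra R) (K : Type)
  (V V' : lmodType (Ci R)) (W W' : semiHilbert D)
  (r : V -> K -> V) (l : K -> W -> W) (r' : V' -> K -> V') (l' : K -> W' -> W')
  (g : tensorForm r l) (g' : tensorForm r' l')
  (f : V -> V') (h : W -> W') (f' : V' -> V) (h' : W' -> W) :
  tensorable r l r' l' f h -> tensorable r' l' r l f' h' ->
  (forall v w v' w', g' (f v) (h w) v' w' = g v w (f' v') (h' w')) ->
  forall (x : tensor r l) (y : tensor r' l'),
    @ip R D (tensor_semi g') (tmap r' l' f h x) y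
    = @ip R D (tensor_semi g) x (tmap r l f' h' y).
Proof.
move=> fh fh' hg x y.
elim/tensor_ind: x => [|s s' hs hs'|v w].
  by rewrite (tmap0 fh) (@ip0l _ _ (tensor_semi g')) (@ip0l _ _ (tensor_semi g)).
  by rewrite (tmapD fh) (@ipDl _ _ (tensor_semi g')) (@ipDl _ _ (tensor_semi g)) hs
    hs'.
elim/tensor_ind: y => [|s s' hs hs'|v' w'].
  by rewrite (tmap0 fh') (@ip0r _ _ (tensor_semi g')) (@ip0r _ _ (tensor_semi g)).
  by rewrite (tmapD fh') (@ipDr _ _ (tensor_semi g')) (@ipDr _ _ (tensor_semi g)) hs
    hs'.
by rewrite (tmapE fh) (tmapE fh') !tensor_ipE.
Qed.

Section InternalCP.
Variables (R : realDomainType) (K D : starAlgebra R).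
Variables (E : semiHilbert K) (H : semiHilbert D) (la : K -> H -> H).
Hypothesis laDl : forall a b x, la (a + b) x = la a x + la b x.
Hypothesis laZl : forall z a x, la (z *: a) x = z *: la a x.
Hypothesis laM : forall a b x, la (a ** b) x = la a (la b x).
Hypothesis la_star : forall a x y, ip (la a x) y = ip x (la (star a) y).

Let la0 x : la 0 x = 0.
Proof. by apply: (addrI (la 0 x)); rewrite -laDl !addr0. Qed.
Let la_sum (I : Type) (s : seq I) (F : I -> K) x :
  la (\sum_(i <- s) F i) x = \sum_(i <- s) la (F i) x.
Proof.
by elim: s => [|i s IH]; rewrite ?big_nil ?la0 // !big_cons laDl IH.
Qed.

Variables (n N : nat) (x : 'I_n -> 'I_N -> E) (phi : 'I_n -> 'I_N -> H).
Variable (f : {scalar mat_alg D n}).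
Hypothesis hf : positive f.

Local Notation J := ('I_n * 'I_N)%type.
Let m := #|{: J}|.
Let e (i : 'I_n) (a : 'I_N) : 'I_m := enum_rank (i, a).

Let sigma (al : mat_alg K m) : (Ci R)^o := f [ffun p =>
  \sum_a \sum_b
    ip (phi p.1 a) (la (al (e p.1 a, e p.2 b)) (phi p.2 b))].

Let sigma_lin : scalar sigma.
Proof.
move=> z al be; rewrite /sigma -linearP; congr (f _).
apply/ffunP => p; rewrite !ffunE scaler_sumr -big_split; apply: eq_bigr => a _.
rewrite scaler_sumr -big_split; apply: eq_bigr => b _ /=.
by rewrite !ffunE laDl laZl ipDr ipZr.
Qed.

Let sigmaL : {scalar mat_alg K m} :=
  HB.pack sigma (GRing.isLinear.Build _ _ _ _ sigma sigma_lin).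

Let sigma_pos : positive sigmaL.
Proof.
move=> be; rewrite /= /sigma.
pose psi k i := \sum_a la (be (k, e i a)) (phi i a).
have -> : [ffun p => \sum_a \sum_b ip (phi p.1 a)
     (la ((star be ** be) (e p.1 a, e p.2 b)) (phi p.2 b))] =
   \sum_k ([ffun p => ip (psi k p.1) (psi k p.2)] : mat_alg D n).
  apply/ffunP => -[i j]; rewrite sum_ffunE !ffunE /=.
  under [RHS]eq_bigr => k _.
    rewrite ffunE /= /psi ip_suml.
    under eq_bigr => a _ do rewrite ip_sumr.
    over.
  rewrite [RHS]exchange_big /=; apply: eq_bigr => a _.
  rewrite [RHS]exchange_big /=; apply: eq_bigr => b _.
  rewrite ffunE /= la_sum ip_sumr; apply: eq_bigr => k _.
  by rewrite !ffunE /= laM -la_star.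
rewrite linear_sum; apply: Ci_ge0_sum => k _.
exact: (@ip_cp _ _ H n (psi k) f hf).
Qed.

Lemma internal_cp : Ci_ge0 (f [ffun p =>
  \sum_a \sum_b ip (phi p.1 a) (la (ip (x p.1 a) (x p.2 b)) (phi p.2 b))]).
Proof.
pose xi (k : 'I_m) := x (enum_val k).1 (enum_val k).2.
have := @ip_cp _ _ E m xi sigmaL sigma_pos.
rewrite /= /sigma; congr (is_true (Ci_ge0 (f _))).
apply/ffunP => -[i j]; rewrite !ffunE /=; apply: eq_bigr => a _.
by apply: eq_bigr => b _; rewrite ffunE /= /xi !enum_rankK.
Qed.

End InternalCP.

(* [semiRep] and [semiHilbert] drop only the non-degeneracy of the inner
   product. *)
Section SemiRepresentations.
Variables (R : realDomainType) (A D : starAlgebra R).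

Record semiRep := SemiRep {
  sr_mod :> semiHilbert D;
  sact : A -> sr_mod -> sr_mod;
  sactDl : forall a b x, sact (a + b) x = sact a x + sact b x;
  sactZl : forall z a x, sact (z *: a) x = z *: sact a x;
  sactM : forall a b x, sact (a ** b) x = sact a (sact b x);
  sact_star : forall a x y, ip (sact a x) y = ip x (sact (star a) y);
  sact_nondeg : forall x, exists s : seq (A * sr_mod),
    x = \sum_(p <- s) sact p.1 p.2 }.

Lemma sact_adj (S : semiRep) a : adjointable (@sact S a).
Proof. by exists (@sact S (star a)) => x y; exact: sact_star. Qed.

Program Definition sep_rep (S : semiRep) (N : submodClosed S)
  (hN : N =i degeneracy S) : rep A D :=
  @Rep R A D (sepN hN) (fun a => sepN_map hN hN (@sact S a)) _ _ _ _ _.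
Next Obligation.
move=> S N hN; cbv beta.
move=> a b x; rewrite -(sepN_surj x) !sepN_mapE ?sactDl; do ?exact: sact_adj.
by rewrite sepN_D.
Qed.
Next Obligation.
move=> S N hN; cbv beta; by move=> z a x; rewrite -(sepN_surj x) !sepN_mapE ?sactZl ?sepN_Z;
  do ?exact: sact_adj.
Qed.
Next Obligation.
move=> S N hN; cbv beta; by move=> a b x; rewrite -(sepN_surj x) !sepN_mapE ?sactM; do ?exact: sact_adj.
Qed.
Next Obligation.
move=> S N hN; cbv beta; by move=> a x y; apply: sepN_map_adj; exact: sact_star.
Qed.
Next Obligation.
move=> S N hN; cbv beta.
move=> x; rewrite -(sepN_surj x); have [s {1}->] := sact_nondeg (repr (x : qmod N)).
exists [seq (p.1, sepN_pi hN p.2) | p <- s]; rewrite big_map.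
elim: s => [|p s IH]; first by rewrite !big_nil; exact: qpi0.
by rewrite !big_cons sepN_D IH sepN_mapE //; exact: sact_adj.
Qed.

Lemma sep_rep_lact (S : semiRep) N hN a x :
  @lact R A D (@sep_rep S N hN) a (sepN_pi hN x) = sepN_pi hN (sact a x).
Proof. exact/sepN_mapE/sact_adj. Qed.

Section SepHom.
Variables (S S' : semiRep) (N : submodClosed S) (N' : submodClosed S').
Variables (hN : N =i degeneracy S) (hN' : N' =i degeneracy S').
Variables (T : S -> S') (hT : adjointable T).
Hypothesis hTa : forall a x, T (sact a x) = sact a (T x).

Lemma sep_hom_adj : @adjointable R D (sep_rep hN) (sep_rep hN')
  (sepN_map hN hN' T).
Proof.
by have [T' h] := hT; exists (sepN_map hN' hN T') => x y; exact: sepN_map_adj.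
Qed.

Lemma sep_hom_lact a x : sepN_map hN hN' T (@lact R A D (sep_rep hN) a x)
  = @lact R A D (sep_rep hN') a (sepN_map hN hN' T x).
Proof.
rewrite -(sepN_surj x) sep_rep_lact !sepN_mapE // hTa.
exact/esym/sep_rep_lact.
Qed.

Definition sep_hom : rep_hom (sep_rep hN) (sep_rep hN') :=
  RepHom sep_hom_adj sep_hom_lact.

Lemma sep_homE x : sep_hom (sepN_pi hN x) = sepN_pi hN' (T x).
Proof. exact: sepN_mapE. Qed.

End SepHom.

End SemiRepresentations.

Section TensorSums.
Variables (C : comNzRingType) (V W : lmodType C) (K : Type).
Variables (r : V -> K -> V) (l : K -> W -> W).

Lemma tens_suml (I : Type) (s : seq I) (F : I -> V) w :
  tens r l (\sum_(i <- s) F i) w = \sum_(i <- s) tens r l (F i) w.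
Proof.
by elim: s => [|i s IH]; rewrite ?big_nil ?tens0l // !big_cons tensDl IH.
Qed.

Lemma tens_sumr (I : Type) (s : seq I) (F : I -> W) v :
  tens r l v (\sum_(i <- s) F i) = \sum_(i <- s) tens r l v (F i).
Proof.
elim: s => [|i s IH]; last by rewrite !big_cons tensDr IH.
rewrite !big_nil; apply: (addrI (tens r l v 0)).
by rewrite -tensDr !addr0.
Qed.

Lemma sum_ind (U : lmodType C) (P : Type) (F : P -> U) (V' W' : lmodType C)
  (r' : V' -> K -> V') (l' : K -> W' -> W') (h : tensor r' l' -> U) :
  h 0 = 0 -> (forall x y, h (x + y) = h x + h y) ->
  (forall v w, exists s, h (tens r' l' v w) = \sum_(p <- s) F p) ->
  forall t, exists s, h t = \sum_(p <- s) F p.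
Proof.
move=> h0 hD ht t; elim/tensor_ind: t => [|x y [s hs] [s' hs']|v w] //.
  by exists [::]; rewrite big_nil.
by exists (s ++ s'); rewrite big_cat hD hs hs'.
Qed.

End TensorSums.

(* External tensor product with a pre-Hilbert space over the scalars; the
   algebra C (x) D of its inner product is identified with D. *)
Section External.
Variables (R : realDomainType) (D : starAlgebra R).
Local Notation C := (Ci R).
Local Notation rC V := (fun (v : V) (z : C) => z *: v).
Local Notation lC W := (fun (z : C) (w : W) => z *: w).

Program Definition ext_form (H1 : semiHilbert (scalar_alg R)) (H2 : semiHilbert D) :
  tensorForm (rC H1) (lC H2) :=
  @TensorForm R D H1 C (rC H1) H2 (lC H2)
  (fun v w v' w' => (ip v v' : C) *: ip w w') _ _ _ _ _.
Next Obligation.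
move=> H1 H2; cbv beta.
move=> v w; apply: balancedC => *.
+ by rewrite ipDr scalerDl.
+ by rewrite ipDr scalerDr.
+ by rewrite ipZr scalerA.
+ by rewrite ipZr !scalerA mulrC.
Qed.
Next Obligation.
move=> H1 H2; cbv beta; by move=> v w v' w'; rewrite starZ -ipC [ip v v']ipC.
Qed.
Next Obligation.
move=> H1 H2; cbv beta; by move=> *; rewrite ipM amulZl.
Qed.
Next Obligation.
move=> H1 H2; cbv beta; by move=> *; rewrite ractZl.
Qed.
Next Obligation.
move=> H1 H2; cbv beta.
move=> n N v w f hf.
have := @internal_cp R (scalar_alg R) D H1 H2 (fun (z : C) w => z *: w)
  _ _ _ _ n N v w f hf.
have -> : [ffun p => \sum_a \sum_b
     ip (w p.1 a) ((ip (v p.1 a) (v p.2 b) : C) *: w p.2 b)] =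
   [ffun p => \sum_a \sum_b
     (ip (v p.1 a) (v p.2 b) : C) *: ip (w p.1 a) (w p.2 b)].
  apply/ffunP => p; rewrite !ffunE; apply: eq_bigr => a _.
  by apply: eq_bigr => b _; rewrite ipZr.
apply.
+ by move=> *; rewrite scalerDl.
+ by move=> *; rewrite scalerA.
+ by move=> *; rewrite scalerA.
+ by move=> *; rewrite ipZl ipZr.
Qed.

Variables (B A : starAlgebra R).

Section Objects.
Variables (H1 : rep B (scalar_alg R)) (H2 : rep A D).
Local Notation T := (tensor (rC H1) (lC H2)).
Local Notation S := (tensor_semi (ext_form H1 H2)).
Local Notation opr b a :=
  (tmap (rC H1) (lC H2) (@lact R B _ H1 b) (@lact R A D H2 a)).

Let able b a : tensorable (rC H1) (lC H2) (rC H1) (lC H2)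
  (@lact R B _ H1 b) (@lact R A D H2 a).
Proof.
by split=> *; rewrite ?lactDr ?lactZr.
Qed.

Let bal (u : T) : bilinearC (fun b a => opr b a u).
Proof.
apply: balancedC => [b b' a|b a a'|z b a|z b a]; move: u;
  apply: tensor_ind => [|x y hx hy|v w].
all: try by rewrite !(tmap0 (able _ _)) ?addr0 ?scaler0.
all: try by rewrite !(tmapD (able _ _)) hx hy ?scalerDr // addrACA.
all: rewrite !(tmapE (able _ _)).
- by rewrite lactDl tensDl.
- by rewrite lactDl tensDr.
- by rewrite lactZl tensZl.
- by rewrite lactZl tensZr.
Qed.

Definition ext_act (t : tensor_alg B A) (u : S) : S :=
  tliftC (fun b a => opr b a u) t.

Let actE b a u : ext_act (tens _ _ b a) u = opr b a u.
Proof. exact: (tliftE (bal u)). Qed.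
Lemma ext_actDl s t u : ext_act (s + t) u = ext_act s u + ext_act t u.
Proof. exact: (tliftD (bal u)). Qed.
Let actZl z t u : ext_act (z *: t) u = z *: ext_act t u.
Proof. exact: (tliftZ (bal u)). Qed.
Lemma ext_act0l u : ext_act 0 u = 0.
Proof. exact: (tlift0 (bal u)). Qed.
Lemma ext_actDr s u v : ext_act s (u + v) = ext_act s u + ext_act s v.
Proof.
elim/tensor_ind: s => [|x y hx hy|b a]; first by rewrite !ext_act0l addr0.
  by rewrite !ext_actDl hx hy addrACA.
by rewrite !actE; exact: (tmapD (able b a)).
Qed.
Lemma ext_act0r s : ext_act s 0 = 0.
Proof. by apply: (addrI (ext_act s 0)); rewrite -ext_actDr !addr0. Qed.

Lemma ext_actE b a x y :
  ext_act (tensC b a) (tens _ _ x y) = tens _ _ (lact b x) (lact a y).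
Proof. by rewrite [LHS]actE (tmapE (able b a)). Qed.

Program Definition ext_semi : semiRep (tensor_alg B A) D :=
  @SemiRep R (tensor_alg B A) D S ext_act ext_actDl actZl _ _ _.
Next Obligation.
cbv beta.
move=> s t u; elim/tensor_ind: s => [|x y hx hy|b a].
+ by rewrite amul0l !ext_act0l.
+ by rewrite amulDl !ext_actDl hx hy.
elim/tensor_ind: t => [|x y hx hy|b' a'].
+ by rewrite amul0r !ext_act0l ext_act0r.
+ by rewrite amulDr !ext_actDl ext_actDr hx hy.
rewrite [X in ext_act X]tensor_alg_mul.
elim/tensor_ind: u => [|x y hx hy|v w]; first by rewrite !ext_act0r.
  by rewrite !ext_actDr hx hy.
by rewrite !ext_actE !lactM.
Qed.
Next Obligation.
cbv beta.
move=> s u v; elim/tensor_ind: s => [|x y hx hy|b a].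
+ by rewrite star0 !ext_act0l ip0l ip0r.
+ by rewrite starD !ext_actDl ipDl ipDr hx hy.
rewrite [X in ext_act X v]tensor_alg_star !actE.
apply: tmap_adj => //= x y x' y'.
by rewrite !lact_star.
Qed.
Next Obligation.
cbv beta.
apply: (sum_ind (h := id)) => // v w.
have [s ->] := lact_nondeg v; have [s' ->] := lact_nondeg w.
exists [seq (tensC p.1 q.1, tens (rC H1) (lC H2) p.2 q.2) | p <- s, q <- s'].
rewrite big_allpairs_dep /= tens_suml; apply: eq_bigr => p _.
by rewrite tens_sumr; apply: eq_bigr => q _; rewrite ext_actE.
Qed.

Definition ext_rep : rep (tensor_alg B A) D :=
  @sep_rep R _ D ext_semi (degeneracy S) (fun=> erefl).

End Objects.

Variable H1 : rep B (scalar_alg R).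

Let hom_able (H2 H2' : rep A D) (T : H2 -> H2') : adjointable T ->
  tensorable (rC H1) (lC H2) (rC H1) (lC H2') (fun x => x) T.
Proof.
by move=> hT; split=> // *; rewrite ?(adjointableD hT) ?(adjointableZ hT).
Qed.

Section Hom.
Variables (H2 H2' : rep A D) (T : rep_hom H2 H2').
Let m := @tmap C C H1 H1 H2 H2' (rC H1) (lC H2) (rC H1) (lC H2') (fun x => x) T.
Let able := hom_able (rh_adj T).

Let mE x y : m (tens _ _ x y) = tens _ _ x (T y).
Proof. exact: (tmapE able). Qed.
Let mD s t : m (s + t) = m s + m t.
Proof. exact: (tmapD able). Qed.
Let m0 : m 0 = 0.
Proof. exact: (tmap0 able). Qed.

Lemma ext_hom_adj :
  @adjointable R D (ext_semi H1 H2) (ext_semi H1 H2') m.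
Proof.
have [T' hT] := rh_adj T.
have aT' : adjointable T' by exists T => x y; rewrite ipC -hT -ipC.
exists (tmap (rC H1) (lC H2) (fun x => x) T').
apply: (tmap_adj able (hom_able aT')).
by move=> v w v' w' /=; rewrite hT.
Qed.

Lemma ext_hom_act t u :
  m (@sact R _ D (ext_semi H1 H2) t u) = @sact R _ D (ext_semi H1 H2') t (m u).
Proof.
rewrite /=; elim/tensor_ind: t => [|x y hx hy|b a].
- by rewrite !ext_act0l m0.
- by rewrite !ext_actDl mD hx hy.
elim/tensor_ind: u => [|x y hx hy|v w].
- by rewrite ext_act0r m0 ext_act0r.
- by rewrite mD !ext_actDr mD hx hy.
by rewrite mE !ext_actE mE rh_lact.
Qed.

Definition ext_hom : rep_hom (ext_rep H1 H2) (ext_rep H1 H2') :=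
  @sep_hom R _ D (ext_semi H1 H2) (ext_semi H1 H2') _ _ _ _ m
    ext_hom_adj ext_hom_act.

Lemma ext_homE (u : tensor (rC H1) (lC H2)) :
  @rh_fun R _ D _ _ ext_hom (sep_pi (tensor_semi (ext_form H1 H2)) u)
  = sep_pi (tensor_semi (ext_form H1 H2')) (m u).
Proof. exact: sep_homE. Qed.

End Hom.

Lemma ext_surj (H2 : rep A D) (x : ext_rep H1 H2) :
  exists u, x = sep_pi (tensor_semi (ext_form H1 H2)) u.
Proof. exact: (@sep_surj R D (tensor_semi (ext_form H1 H2)) x). Qed.

Program Definition ext_functor : functor (repCat A D) (repCat (tensor_alg B A) D) :=
  @Functor (repCat A D) (repCat (tensor_alg B A) D)
  (ext_rep H1) ext_hom _ _.
Next Obligation.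
cbv beta.
move=> H2; apply: rep_hom_eq => x; have [u ->] := ext_surj x.
rewrite [LHS]ext_homE.
exact: (congr1 (sep_pi (tensor_semi (ext_form H1 H2))) (tmap_id u)).
Qed.
Next Obligation.
cbv beta.
move=> H2 H2' H2'' T' T; apply: rep_hom_eq => x.
have [u ->] := ext_surj x.
rewrite [LHS]ext_homE /= [RHS](congr1 (ext_hom T') (ext_homE T u)).
rewrite [RHS]ext_homE.
apply: (congr1 (sep_pi (tensor_semi (ext_form H1 H2'')))).
apply: tmap_comp; exact/hom_able/rh_adj.
Qed.

End External.

Section Internal.
Variables (R : realDomainType) (K D : starAlgebra R).

Program Definition int_form (E : semiHilbert K) (H : rep K D) :
  tensorForm (@ract R K E) (@lact R K D H) :=
  @TensorForm R D E K (@ract R K E) H (@lact R K D H)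
  (fun x phi y psi => ip phi (lact (ip x y) psi)) _ _ _ _ _.
Next Obligation.
move=> E H; cbv beta.
move=> v w; split=> *.
+ by rewrite ipDr lactDl ipDr.
+ by rewrite lactDr ipDr.
+ by rewrite ipZr lactZl ipZr.
+ by rewrite lactZr ipZr.
+ by rewrite ipM lactM.
Qed.
Next Obligation.
move=> E H; cbv beta; by move=> v w v' w'; rewrite -[RHS]ipC lact_star -ipC.
Qed.
Next Obligation.
move=> E H; cbv beta; by move=> *; rewrite lact_ract ipM.
Qed.
Next Obligation.
move=> E H; cbv beta; by move=> *; rewrite lact_ract.
Qed.
Next Obligation.
move=> E H; cbv beta.
move=> n N v w f hf; apply: internal_cp hf.
+ exact: lactDl.
+ exact: lactZl.
+ exact: lactM.
+ exact: lact_star.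
Qed.

Variable A : starAlgebra R.

Section Objects.
Variables (E : rep A K) (H : rep K D).
Local Notation T := (tensor (@ract R K E) (@lact R K D H)).
Local Notation S := (tensor_semi (int_form E H)).

Definition int_act (a : A) : S -> S :=
  tmap (@ract R K E) (@lact R K D H) (@lact R A K E a) (fun x => x).

Let able a : tensorable (@ract R K E) (@lact R K D H) (@ract R K E)
  (@lact R K D H) (@lact R A K E a) (fun x => x).
Proof. by split=> // *; rewrite ?lactDr ?lactZr ?lact_ract. Qed.

Lemma int_actE a x y :
  int_act a (tens _ _ x y) = tens (@ract R K E) (@lact R K D H) (lact a x) y.
Proof. exact: (tmapE (able a)). Qed.
Lemma int_actDr a s t : int_act a (s + t) = int_act a s + int_act a t.
Proof. exact: (tmapD (able a)). Qed.
Lemma int_act0r a : int_act a 0 = 0.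
Proof. exact: (tmap0 (able a)). Qed.

Program Definition int_semi : semiRep A D :=
  @SemiRep R A D S int_act _ _ _ _ _.
Next Obligation.
cbv beta.
move=> a b; elim/tensor_ind => [|x y hx hy|v w].
+ by rewrite !int_act0r addr0.
+ by rewrite !int_actDr hx hy addrACA.
+ by rewrite !int_actE lactDl tensDl.
Qed.
Next Obligation.
cbv beta.
move=> z a; elim/tensor_ind => [|x y hx hy|v w].
+ by rewrite !int_act0r scaler0.
+ by rewrite !int_actDr hx hy scalerDr.
+ by rewrite !int_actE lactZl tensZl.
Qed.
Next Obligation.
cbv beta.
move=> a b; elim/tensor_ind => [|x y hx hy|v w].
+ by rewrite !int_act0r.
+ by rewrite !int_actDr hx hy.
+ by rewrite !int_actE lactM.
Qed.
Next Obligation.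
cbv beta.
move=> a; apply: (tmap_adj (able a) (able (star a))).
by move=> x phi y psi /=; rewrite lact_star.
Qed.
Next Obligation.
cbv beta.
apply: (sum_ind (h := id)) => // v w.
have [s ->] := lact_nondeg v.
exists [seq (p.1, tens (@ract R K E) (@lact R K D H) p.2 w) | p <- s].
rewrite big_map tens_suml; apply: eq_bigr => p _.
by rewrite int_actE.
Qed.

Definition int_rep : rep A D :=
  @sep_rep R A D int_semi (degeneracy S) (fun=> erefl).

End Objects.

Variable E : rep A K.

Let hom_able (H H' : rep K D) (T : H -> H') : adjointable T ->
  (forall k x, T (lact k x) = lact k (T x)) ->
  tensorable (@ract R K E) (@lact R K D H) (@ract R K E) (@lact R K D H')
    (fun x => x) T.
Proof.
by move=> hT hl; split=> // *; rewrite ?(adjointableD hT) ?(adjointableZ hT).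
Qed.

Section Hom.
Variables (H H' : rep K D) (T : rep_hom H H').
Let m := @tmap (Ci R) K E E H H' (@ract R K E) (@lact R K D H) (@ract R K E)
  (@lact R K D H') (fun x => x) T.
Let able := hom_able (rh_adj T) (rh_lact T).

Let mE x y : m (tens _ _ x y) = tens _ _ x (T y).
Proof. exact: (tmapE able). Qed.
Let mD s t : m (s + t) = m s + m t.
Proof. exact: (tmapD able). Qed.
Let m0 : m 0 = 0.
Proof. exact: (tmap0 able). Qed.

Lemma int_hom_adj : @adjointable R D (int_semi E H) (int_semi E H') m.
Proof.
have [T' hT] := rh_adj T.
have aT' : adjointable T' by exists T => x y; rewrite ipC -hT -ipC.
have lT' := rh_adj_lact hT.
exists (tmap (@ract R K E) (@lact R K D H) (fun x => x) T').
apply: (tmap_adj able (hom_able aT' lT')).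
by move=> v w v' w' /=; rewrite hT lT'.
Qed.

Lemma int_hom_act a u :
  m (@sact R _ D (int_semi E H) a u) = @sact R _ D (int_semi E H') a (m u).
Proof.
rewrite /=; elim/tensor_ind: u => [|x y hx hy|v w].
- by rewrite int_act0r m0 int_act0r.
- by rewrite mD !int_actDr mD hx hy.
by rewrite mE !int_actE mE.
Qed.

Definition int_hom : rep_hom (int_rep E H) (int_rep E H') :=
  @sep_hom R A D (int_semi E H) (int_semi E H') _ _ _ _ m
    int_hom_adj int_hom_act.

Lemma int_homE (u : tensor (@ract R K E) (@lact R K D H)) :
  @rh_fun R A D _ _ int_hom (sep_pi (tensor_semi (int_form E H)) u)
  = sep_pi (tensor_semi (int_form E H')) (m u).
Proof. exact: sep_homE. Qed.

End Hom.

Lemma int_surj (H : rep K D) (x : int_rep E H) :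
  exists u, x = sep_pi (tensor_semi (int_form E H)) u.
Proof. exact: (@sep_surj R D (tensor_semi (int_form E H)) x). Qed.

Program Definition rieffel_induction : functor (repCat K D) (repCat A D) :=
  @Functor (repCat K D) (repCat A D) (int_rep E) int_hom _ _.
Next Obligation.
cbv beta.
move=> H; apply: rep_hom_eq => x; have [u ->] := int_surj x.
rewrite [LHS]int_homE.
exact: (congr1 (sep_pi (tensor_semi (int_form E H))) (tmap_id u)).
Qed.
Next Obligation.
cbv beta.
move=> H H' H'' T' T; apply: rep_hom_eq => x.
have [u ->] := int_surj x.
rewrite [LHS]int_homE /= [RHS](congr1 (int_hom T') (int_homE T u)).
rewrite [RHS]int_homE.
apply: (congr1 (sep_pi (tensor_semi (int_form E H'')))).
apply: tmap_comp; apply: hom_able; solve [exact: rh_adj|exact: rh_lact].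
Qed.

End Internal.

(* A as a right module over itself, with A acting by left multiplication. *)
Section Regular.
Variables (R : realDomainType) (A : unitalStarAlgebra R).

Program Definition reg_semi : semiHilbert A :=
  @SemiHilbert R A A (@amul R A) (fun a b => star a ** b) _ _ _ _ _ _ _ _ _ _.
Next Obligation. by move=> *; rewrite /= amulDl. Qed.
Next Obligation. by move=> *; rewrite /= amulDr. Qed.
Next Obligation. by move=> *; rewrite /= amulZl. Qed.
Next Obligation. by move=> *; rewrite /= amulZr. Qed.
Next Obligation. by move=> *; rewrite /= amulA. Qed.
Next Obligation. by move=> *; rewrite /= amulDr. Qed.
Next Obligation. by move=> *; rewrite /= amulZr. Qed.
Next Obligation. by move=> *; rewrite /= amulA. Qed.
Next Obligation. by move=> *; rewrite /= starM starK. Qed.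
Next Obligation. by move=> n x f; exact: cp_gram. Qed.

Program Definition reg_hilbert : preHilbert A := @PreHilbert R A reg_semi _.
Next Obligation.
move=> x /(_ (aone A)); rewrite /= amul1r => h.
by rewrite -[x]starK h star0.
Qed.

Program Definition reg_rep : rep A A :=
  @Rep R A A reg_hilbert (@amul R A) _ _ _ _ _.
Next Obligation. by move=> *; rewrite /= amulDl. Qed.
Next Obligation. by move=> *; rewrite /= amulZl. Qed.
Next Obligation. by move=> *; rewrite /= amulA. Qed.
Next Obligation. by move=> *; rewrite /= starM amulA. Qed.
Next Obligation.
by move=> x; exists [:: (aone A, x)]; rewrite big_seq1 /= amul1l.
Qed.

End Regular.

Record starIdeal (R : realDomainType) (B : starAlgebra R) := StarIdeal {
  si_set :> submodClosed B;
  si_mull : forall b c, c \in si_set -> b ** c \in si_set;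
  si_mulr : forall b c, c \in si_set -> c ** b \in si_set;
  si_star : forall c, c \in si_set -> star c \in si_set }.

Section Ideal.
Variables (R : realDomainType) (B : starAlgebra R) (I : starIdeal B).

Record ideal_car := IdealCar { ival : B; ivalP : ival \in si_set I }.

HB.instance Definition _ := [isSub for ival].
HB.instance Definition _ := [Choice of ideal_car by <:].
HB.instance Definition _ := [SubChoice_isSubLmodule of ideal_car by <:].

Lemma ival_inj : injective ival. Proof. exact: val_inj. Qed.

Definition ideal_mul (b c : ideal_car) : ideal_car :=
  IdealCar (si_mull (ival b) (ivalP c)).
Definition ideal_star (b : ideal_car) : ideal_car :=
  IdealCar (si_star (ivalP b)).

Program Definition ideal_alg : starAlgebra R :=
  @StarAlgebra R ideal_car ideal_mul ideal_star _ _ _ _ _ _ _ _ _.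
Next Obligation. by move=> *; apply: ival_inj; rewrite /= amulA. Qed.
Next Obligation. by move=> *; apply: ival_inj; rewrite /= amulDl. Qed.
Next Obligation. by move=> *; apply: ival_inj; rewrite /= amulDr. Qed.
Next Obligation. by move=> *; apply: ival_inj; rewrite /= amulZl. Qed.
Next Obligation. by move=> *; apply: ival_inj; rewrite /= amulZr. Qed.
Next Obligation. by move=> *; apply: ival_inj; rewrite /= starD. Qed.
Next Obligation. by move=> *; apply: ival_inj; rewrite /= starZ. Qed.
Next Obligation. by move=> *; apply: ival_inj; rewrite /= starK. Qed.
Next Obligation. by move=> *; apply: ival_inj; rewrite /= starM. Qed.

Definition ideal_act (b : B) (c : ideal_alg) : ideal_alg :=
  IdealCar (si_mull b (ivalP c)).

End Ideal.

Section GNS.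
Variables (R : realDomainType) (B : unitalStarAlgebra R) (I : starIdeal B).
Variables (omega : {scalar ideal_alg I}).
Hypothesis omega_pos : positive omega.
Local Notation C := (Ci R).
Local Notation B0 := (ideal_alg I).

Definition gns_ip (b c : B0) : C := omega (star b ** c).

Lemma gns_ipDr b c c' : gns_ip b (c + c') = gns_ip b c + gns_ip b c'.
Proof. by rewrite /gns_ip amulDr linearD. Qed.
Lemma gns_ipZr z b c : gns_ip b (z *: c) = z * gns_ip b c.
Proof. by rewrite /gns_ip amulZr linearZ. Qed.
Lemma gns_ipDl b b' c : gns_ip (b + b') c = gns_ip b c + gns_ip b' c.
Proof. by rewrite /gns_ip starD amulDl linearD. Qed.
Lemma gns_ipZl z b c : gns_ip (z *: b) c = Ci_conj z * gns_ip b c.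
Proof. by rewrite /gns_ip starZ amulZl linearZ. Qed.

Lemma gns_ipC b c : gns_ip b c = Ci_conj (gns_ip c b).
Proof.
have hp d : complex.Im (gns_ip d d) = 0.
  by have /andP[/eqP] := omega_pos d.
pose i : C := Complex 0 1.
have := hp (b + i *: c); have := hp (b + c).
rewrite !(gns_ipDr, gns_ipDl, gns_ipZr, gns_ipZl).
have := hp b; have := hp c.
case: (gns_ip b b) (gns_ip c c) (gns_ip b c) (gns_ip c b) =>
  [b1 b2] [c1 c2] [p1 p2] [q1 q2] /= -> ->.
rewrite /Ci_conj /= => h1 h2; congr Complex; lra.
Qed.

Definition gelfand_ideal : {pred B0} := fun b => omega (star b ** b) == 0.

Program Definition gns_semi : semiHilbert (scalar_alg R) :=
  @SemiHilbert R (scalar_alg R) B0 (fun b z => (z : C) *: b) gns_ip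
    _ _ _ _ _ _ _ _ _ _.
Next Obligation. by move=> *; rewrite /= scalerDr. Qed.
Next Obligation. by move=> *; rewrite /= scalerDl. Qed.
Next Obligation. by move=> *; rewrite /= !scalerA mulrC. Qed.
Next Obligation. by move=> *; rewrite /= !scalerA. Qed.
Next Obligation. by move=> *; rewrite /= scalerA mulrC. Qed.
Next Obligation. exact: gns_ipDr. Qed.
Next Obligation. exact: gns_ipZr. Qed.
Next Obligation. by move=> *; rewrite /= gns_ipZr mulrC. Qed.
Next Obligation. exact: gns_ipC. Qed.
Next Obligation.
by apply: psd_cp; [exact: gns_ipDr|exact: gns_ipZr|exact: gns_ipC|].
Qed.

Lemma gelfand_idealE : gelfand_ideal =i degeneracy gns_semi.
Proof.
move=> b; apply/idP/degeneracyP => [/eqP h c|h]; last exact/eqP/h.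
exact: (psd_isotropic gns_ipDr gns_ipZr gns_ipC omega_pos).
Qed.

Lemma gelfand_ideal_closed : submod_closed gelfand_ideal.
Proof.
have [h0 hZ] := degeneracy_closed gns_semi.
split=> [|z b c]; rewrite !gelfand_idealE //; exact: hZ.
Qed.

HB.instance Definition _ :=
  GRing.isSubmodClosed.Build C B0 gelfand_ideal gelfand_ideal_closed.

Program Definition gns_semirep : semiRep B (scalar_alg R) :=
  @SemiRep R B (scalar_alg R) gns_semi (@ideal_act R B I) _ _ _ _ _.
Next Obligation. by move=> *; apply: ival_inj; rewrite /= amulDl. Qed.
Next Obligation. by move=> *; apply: ival_inj; rewrite /= amulZl. Qed.
Next Obligation. by move=> *; apply: ival_inj; rewrite /= amulA. Qed.
Next Obligation.
move=> b x y; rewrite /= /gns_ip; congr (omega _).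
by apply: ival_inj; rewrite /= starM amulA.
Qed.
Next Obligation.
move=> x; exists [:: (aone B, x)]; rewrite big_seq1.
by apply: ival_inj; rewrite /= amul1l.
Qed.

(* The GNS representation of B on B0 / gelfand_ideal. *)
Definition gns_rep : rep B (scalar_alg R) :=
  @sep_rep R B (scalar_alg R) gns_semirep gelfand_ideal gelfand_idealE.

End GNS.

(* Main.v *)
Require Import Defs.
From mathcomp Require Import all_boot all_order all_algebra.
From mathcomp Require Import boolp.

Set Implicit Arguments.
Unset Strict Implicit.
Unset Printing Implicit Defensive.

Import GRing.Theory.
Local Open Scope ring_scope.

(* Before separation, [v (x) phi |-> [v (x) 1] (x) phi] preserves inner products
   and intertwines the actions.  It is onto because
   [v (x) a] (x) phi = [v (x) 1].a (x) phi = [v (x) 1] (x) a.phi.  It therefore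
   induces a unitary intertwiner between the separated modules, natural in the
   second factor; the equivalence sought is its inverse. *)

(** Componentwise inverses are again natural; [is_iso] only asserts that they exist, so [cid]
    chooses them. *)
Lemma naturally_equivalent_sym (X Y : category) (F G : functor X Y) :
  naturally_equivalent F G -> naturally_equivalent G F.
Proof.
move=> [eta [iso nat]]; have inv a := cid (iso a).
exists (fun a => projT1 (inv a)); split=> [a|a b f].
  by exists (eta a); have [] := projT2 (inv a).
case: (inv a) (inv b) => [u [_ au]] [w [wb _]] /=.
(* Insert [eta a] after [u] on the right, apply naturality of [eta], then cancel [w] against
   [eta b]. *)
rewrite -[LHS]cat_idr -au cat_compA -(cat_compA w) -nat.
by rewrite !cat_compA wb cat_idl.
Qed.

(** Any section of [g] is an adjoint: [<g x, y> = <g x, g (g' y)> = <x, g' y>]. The inner products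
    may be degenerate, so [g'] need not be a two-sided inverse. *)
Lemma isometry_onto_adjoint (R : realDomainType) (D : starAlgebra R)
    (S S' : semiHilbert D) (g : S -> S') :
  (forall x y, ip (g x) (g y) = ip x y) -> (forall y, exists x, g x = y) ->
  exists2 g' : S' -> S, cancel g' g & forall x y, ip (g x) y = ip x (g' y).
Proof.
move=> iso /choice[g' g'K]; exists g' => // x y.
by rewrite -[in LHS](g'K y) iso.
Qed.

Lemma rep_unitary_is_iso (R : realDomainType) (A D : starAlgebra R)
    (H H' : repCat A D) (T : cat_hom H H') :
  let f : (H : rep A D) -> (H' : rep A D) := T : rep_hom _ _ in
  (forall x y, ip (f x) (f y) = ip x y) -> (forall y, exists x, f x = y) ->
  is_iso T.
Proof.
move=> f iso onto; have [f' f'K adj] := isometry_onto_adjoint iso onto.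
have adj' : adjointable f'.
  by exists f => x y; rewrite ipC -adj -ipC.
exists (RepHom adj' (rh_adj_lact adj)); split; apply: rep_hom_eq => x /=.
  (* Non-degeneracy makes the section a left inverse too: [f' (f x)] and [x] have the same image
     under the isometry [f]. *)
  by apply: ip_ext => y; rewrite -iso [X in ip X _]f'K iso.
exact: f'K.
Qed.

(** By strong non-degeneracy [x] is a sum of terms [a.y], each fixed by the unit. *)
Lemma lact_aone (R : realDomainType) (A : unitalStarAlgebra R)
    (D : starAlgebra R) (H : rep A D) (x : H) : lact (aone A) x = x.
Proof.
have [s ->] := lact_nondeg x.
elim: s => [|p s IH]; rewrite ?big_nil ?big_cons.
  by apply: (addrI (lact (aone A) (0 : H))); rewrite -lactDr !addr0.
by rewrite lactDr IH -lactM amul1l.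
Qed.

Lemma sact0l (R : realDomainType) (A D : starAlgebra R) (S : semiRep A D)
    (x : S) : sact (0 : A) x = 0.
Proof. by apply: (addrI (sact (0 : A) x)); rewrite -sactDl !addr0. Qed.

Section Induction.
Variables (R : realDomainType) (A : unitalStarAlgebra R) (B D : starAlgebra R).
Variable V : rep B (scalar_alg R).
Local Notation C := (Ci R).
Local Notation E := (ext_rep V (reg_rep A)).
Local Notation rC V := (fun (v : V) (z : C) => z *: v).
Local Notation lC W := (fun (z : C) (w : W) => z *: w).

Definition ext_reg_pi (v : V) (a : A) : E :=
  sep_pi (tensor_semi (ext_form V (reg_rep A))) (tens (rC V) (lC A) v a).

Lemma ext_reg_piDl v v' a :
  ext_reg_pi (v + v') a = ext_reg_pi v a + ext_reg_pi v' a.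
Proof. by rewrite /ext_reg_pi tensDl; exact: sepN_D. Qed.

Lemma ext_reg_piZl z v a : ext_reg_pi (z *: v) a = z *: ext_reg_pi v a.
Proof. by rewrite /ext_reg_pi tensZl; exact: sepN_Z. Qed.

Lemma ext_reg_pi_ip v a v' a' :
  ip (ext_reg_pi v a) (ext_reg_pi v' a') = (ip v v' : C) *: (star a ** a').
Proof. by rewrite [LHS]sepN_ip tensor_ipE. Qed.

Lemma ext_reg_pi_ract v a a' :
  ract (ext_reg_pi v a) a' = ext_reg_pi v (a ** a').
Proof. by rewrite [LHS]sepN_ract tensor_ractE. Qed.

Lemma ext_reg_pi_lact b a v a' :
  lact (tensC b a : tensor_alg B A) (ext_reg_pi v a') =
  ext_reg_pi (lact b v) (a ** a').
Proof. by rewrite [LHS]sep_rep_lact [sact _ _]ext_actE. Qed.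

Lemma ext_reg_ind (P : E -> Prop) :
  P 0 -> (forall x y, P x -> P y -> P (x + y)) ->
  (forall v a, P (ext_reg_pi v a)) -> forall x, P x.
Proof.
move=> P0 PD Ppi x; have [u ->] := ext_surj x.
elim/tensor_ind: u => [//|u u' hu hu'|v a]; last exact: Ppi.
by rewrite [sep_pi _ _]sepN_D; exact: PD.
Qed.

Section Objects.
Variable H : rep A D.
Local Notation S := (ext_semi V H).
Local Notation S' := (int_semi E H).
Local Notation tensE := (tens (@ract R A E) (@lact R A D H)).

Definition unit_tens : S -> S' :=
  tlift (fun v phi => tensE (ext_reg_pi v (aone A)) phi).

Let bal : bilinearC (fun v phi => tensE (ext_reg_pi v (aone A)) phi).
Proof.
apply: balancedC => *.
- by rewrite ext_reg_piDl tensDl.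
- by rewrite tensDr.
- by rewrite ext_reg_piZl tensZl.
- by rewrite tensZr.
Qed.

Lemma unit_tensE v phi :
  unit_tens (tens _ _ v phi) = tensE (ext_reg_pi v (aone A)) phi.
Proof. exact: (tliftE bal). Qed.
Lemma unit_tensD s t : unit_tens (s + t) = unit_tens s + unit_tens t.
Proof. exact: (tliftD bal). Qed.
Lemma unit_tens0 : unit_tens 0 = 0.
Proof. exact: (tlift0 bal). Qed.

Lemma tens_ext_reg_pi v a phi :
  tensE (ext_reg_pi v a) phi = tensE (ext_reg_pi v (aone A)) (lact a phi).
Proof. by rewrite -tensK ext_reg_pi_ract amul1l. Qed.

(** On elementary tensors, [<[v (x) 1], [v' (x) 1]> = <v, v'> 1] acts on the second factor as a
    scalar. *)
Lemma unit_tens_ip s t : ip (unit_tens s) (unit_tens t) = ip s t.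
Proof.
elim/tensor_ind: s => [|x y hx hy|v phi]; first by rewrite unit_tens0 !ip0l.
  by rewrite unit_tensD !ipDl hx hy.
elim/tensor_ind: t => [|x y hx hy|v' phi']; first by rewrite unit_tens0 !ip0r.
  by rewrite unit_tensD !ipDr hx hy.
rewrite !unit_tensE !tensor_ipE /= [X in lact X _]ext_reg_pi_ip amul1r.
have -> : star (aone A) = aone A.
  by rewrite -[LHS]amul1l -[X in X ** _]starK -starM amul1l starK.
by rewrite lactZl lact_aone ipZr.
Qed.

Lemma unit_tens_onto t : exists s, unit_tens s = t.
Proof.
elim/tensor_ind: t => [|_ _ [s <-] [s' <-]|x phi].
- by exists 0; exact: unit_tens0.
- by exists (s + s'); exact: unit_tensD.
(* The first factor is itself a sum of classes [[v (x) a]], hence a second induction. *)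
elim/ext_reg_ind: x => [|x y [s hs] [s' hs']|v a].
- by exists 0; rewrite tens0l unit_tens0.
- by exists (s + s'); rewrite unit_tensD hs hs' tensDl.
by exists (tens _ _ v (lact a phi)); rewrite unit_tensE -tens_ext_reg_pi.
Qed.

Lemma unit_tens_act c s : unit_tens (sact c s) = sact c (unit_tens s).
Proof.
elim/tensor_ind: c => [|x y hx hy|b a].
- rewrite [X in unit_tens X](sact0l (S := S)) unit_tens0.
  exact/esym/(sact0l (S := S')).
- rewrite [X in unit_tens X](sactDl (s := S)) unit_tensD hx hy.
  exact/esym/(sactDl (s := S')).
elim/tensor_ind: s => [|x y hx hy|v phi].
- rewrite [X in unit_tens X]ext_act0r unit_tens0; exact/esym/int_act0r.
- rewrite [X in unit_tens X]ext_actDr !unit_tensD hx hy.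
  exact/esym/int_actDr.
rewrite [X in unit_tens X]ext_actE !unit_tensE [RHS]int_actE.
(* The action turns [[v (x) 1]] into [[b.v (x) a]], and balancing moves [a] over to [phi]. *)
rewrite [X in tens _ _ X phi]ext_reg_pi_lact amul1r.
exact/esym/tens_ext_reg_pi.
Qed.

Lemma unit_tens_adj : @adjointable R D S S' unit_tens.
Proof.
have [g _ adj] := isometry_onto_adjoint unit_tens_ip unit_tens_onto.
by exists g.
Qed.

(** [unit_tens] descends to the quotients because adjointable maps preserve degeneracy spaces. *)
Definition ext_to_int : rep_hom (ext_rep V H) (int_rep E H) :=
  sep_hom (fun=> erefl) (fun=> erefl) unit_tens_adj unit_tens_act.

Lemma ext_to_intE u :
  ext_to_int (sep_pi S u) = sep_pi S' (unit_tens u).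
Proof. exact: sep_homE. Qed.

Lemma ext_to_int_is_iso :
  @is_iso (repCat (tensor_alg B A) D) _ _ ext_to_int.
Proof.
apply: rep_unitary_is_iso => [x y|y].
  have [u ->] := ext_surj x; have [w ->] := ext_surj y.
  rewrite !ext_to_intE [LHS]sepN_ip unit_tens_ip; exact/esym/sepN_ip.
have [u ->] := int_surj y; have [s <-] := unit_tens_onto u.
by exists (sep_pi S s); exact: ext_to_intE.
Qed.

End Objects.

Lemma unit_tens_natural (H H' : rep A D) (T : rep_hom H H') u :
  unit_tens (tmap (rC V) (lC H') (fun v => v) T u) =
  tmap (@ract R A E) (@lact R A D H') (fun x => x) T (unit_tens u).
Proof.
have hT := rh_adj T.
have ableC : tensorable (rC V) (lC H) (rC V) (lC H') (fun v => v) T.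
  by split=> // *; rewrite ?(adjointableD hT) ?(adjointableZ hT).
(* Balancing over [A] is respected because [T] intertwines the actions of [A]. *)
have ableA : tensorable (@ract R A E) (@lact R A D H) (@ract R A E)
    (@lact R A D H') (fun x => x) T.
  by split=> // *; rewrite ?(adjointableD hT) ?(adjointableZ hT) ?rh_lact.
elim/tensor_ind: u => [|x y hx hy|v phi].
- by rewrite (tmap0 ableC) !unit_tens0 (tmap0 ableA).
- by rewrite (tmapD ableC) !unit_tensD (tmapD ableA) hx hy.
by rewrite (tmapE ableC) !unit_tensE (tmapE ableA).
Qed.

(** [V] is any representation of [B] on a pre-Hilbert space; the GNS representation is the case
    needed below. *)
Lemma ext_functor_rieffel_induction :
  naturally_equivalent (ext_functor D A V) (rieffel_induction D E).
Proof.
exists ext_to_int; split=> [H|H H' T]; first exact: ext_to_int_is_iso.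
apply: rep_hom_eq => x; have [u ->] := ext_surj x.
rewrite [LHS](congr1 (ext_to_int H') (ext_homE T u)) ext_to_intE.
rewrite [RHS](congr1 (int_hom E T) (ext_to_intE u)) int_homE.
by rewrite unit_tens_natural.
Qed.

End Induction.

Theorem proposition7p8 (R : realDomainType) (Ared B : unitalStarAlgebra R)
    (B0 : starIdeal B) (omega : {scalar ideal_alg B0})
    (omega_pos : positive omega) (D : starAlgebra R) :
  let GNS : rep B (scalar_alg R) := gns_rep omega_pos in
  let E : rep (tensor_ualg B Ared) Ared := ext_rep GNS (reg_rep Ared) in
  @naturally_equivalent (repCat Ared D) (repCat (tensor_ualg B Ared) D)
    (rieffel_induction D E) (ext_functor D Ared GNS).
Proof. exact/naturally_equivalent_sym/ext_functor_rieffel_induction. Qed.
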